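(* Let $(A,X)$ be a primitive axial algebra of Jordan type $\tfrac12$ over a field $\mathbb{F}$ with $\operatorname{char}\mathbb{F}\neq 2$. If $\operatorname{char}\mathbb{F}=3$, assume moreover that $X$ linearly spans $A$. Then the subalgebra $\langle\!\langle a,b\rangle\!\rangle$ generated by $a$ and $b$ is solid for all $a,b\in X$ if and only if $A$ is a Jordan algebra.
   Context: Algebras are commutative but not necessarily associative. For an algebra $A$ over a field $\mathbb{F}$ ($\operatorname{char}\mathbb{F}\ne2$), $a\in A$ and $\lambda\in\mathbb{F}$, put $A_\lambda(a)=\{x\in A: ax=\lambda x\}$. A nonzero idempotent $a\in A$ is a $\mathcal{J}(\tfrac12)$-axis if $A=A_1(a)\oplus A_0(a)\oplus A_{1/2}(a)$ and $A_1(a)A_1(a)\subseteq A_1(a)$, $A_0(a)A_0(a)\subseteq A_0(a)$, $A_1(a)A_0(a)=0$, $A_1(a)A_{1/2}(a)\subseteq A_{1/2}(a)$, $A_0(a)A_{1/2}(a)\subseteq A_{1/2}(a)$, $A_{1/2}(a)A_{1/2}(a)\subseteq A_1(a)\oplus A_0(a)$. It is primitive if $A_1(a)=\mathbb{F}a$. A primitive axial algebra of Jordan type $\tfrac12$ is a pair $(A,X)$ where $X\subset A$ is a set of primitive $\mathcal{J}(\tfrac12)$-axes generating $A$ as an algebra. A primitive idempotent of an algebra $B$ over a field $\mathbb{K}$ is a nonzero idempotent $c\in B$ with $\{x\in B: cx=x\}=\mathbb{K}c$. For $a,b\in X$, the subalgebra $B=\langle\!\langle a,b\rangle\!\rangle$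 is solid if, for an (equivalently every) algebraic closure $\mathbb{E}$ of $\mathbb{F}$, every primitive idempotent of $B\otimes_{\mathbb{F}}\mathbb{E}$ is a $\mathcal{J}(\tfrac12)$-axis of $A\otimes_{\mathbb{F}}\mathbb{E}$. (If $a=b$, then $B=\mathbb{F}a$ and the condition holds trivially.) A Jordan algebra is a commutative algebra satisfying $(x^2y)x=x^2(yx)$ for all $x,y$. *)

(* Defs.v *)
(* Built on Mathematical Components and the classical layer of
   MathComp-Analysis (sets and excluded middle only). *)
From HB Require Import structures.
From mathcomp Require Import all_boot all_order all_algebra.
From mathcomp Require Import generic_quotient boolp classical_sets.

Set Implicit Arguments.
Unset Strict Implicit.
Unset Printing Implicit Defensive.

Import GRing.Theory.
Local Open Scope ring_scope.
Local Open Scope quotient_scope.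
Local Open Scope classical_set_scope.

(* Commutative algebras, not necessarily associative, unital or
   finite-dimensional. *)
Record comAlg (F : fieldType) := ComAlg {
  comAlg_sort :> lmodType F;
  amul : comAlg_sort -> comAlg_sort -> comAlg_sort;
  amulC : commutative amul;
  amul_linear : forall a, linear (amul a)
}.
Arguments amul {F c}.

Notation "x ** y" := (amul x y) (at level 40, left associativity) : ring_scope.

Section Algebras.
Variables (F : fieldType) (A : comAlg F).
Implicit Types (a b c x y : A) (S U X : set A).

Definition linear_span S : set A :=
  [set x | forall U, U 0 ->
     (forall (k : F) u v, U u -> U v -> U (k *: u + v)) ->
     S `<=` U -> U x].

Definition subalgebra U : Prop :=
  [/\ U 0,
      forall (k : F) u v, U u -> U v -> U (k *: u + v)
    & forall u v, U u -> U v -> U (u ** v)].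

Definition generated_subalgebra S : set A :=
  [set x | forall U, subalgebra U -> S `<=` U -> U x].

Definition eigspace (l : F) a : set A := [set x | a ** x = l *: x].

Definition idempotent_elt a : Prop := a ** a = a.

Definition J_half_axis a : Prop :=
  let A1 := eigspace 1 a in
  let A0 := eigspace 0 a in
  let Ah := eigspace 2%:R^-1 a in
  let A10 := [set x | exists x1 x0, [/\ A1 x1, A0 x0 & x = x1 + x0]] in
  [/\ a <> 0,
      idempotent_elt a,
      (forall x, exists x1 x0 xh,
         [/\ A1 x1, A0 x0, Ah xh & x = x1 + x0 + xh]) /\
      (forall x1 x0 xh, A1 x1 -> A0 x0 -> Ah xh ->
         x1 + x0 + xh = 0 -> [/\ x1 = 0, x0 = 0 & xh = 0])
    & [/\ forall x y, A1 x -> A1 y -> A1 (x ** y),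
          forall x y, A0 x -> A0 y -> A0 (x ** y),
          forall x y, A1 x -> A0 y -> x ** y = 0,
          forall x y, A1 x -> Ah y -> Ah (x ** y)
        & (forall x y, A0 x -> Ah y -> Ah (x ** y)) /\
          (forall x y, Ah x -> Ah y -> A10 (x ** y))]].

Definition primitive_J_half_axis a : Prop :=
  J_half_axis a /\ eigspace 1 a = [set k *: a | k in [set: F]].

Definition primitive_axial_algebra X : Prop :=
  (forall a, X a -> primitive_J_half_axis a) /\
  generated_subalgebra X = [set: A].

(* Primitive idempotents of a subalgebra B of A. *)
Definition primitive_idempotent_in (B : set A) c : Prop :=
  [/\ B c, c <> 0, idempotent_elt c
    & B `&` [set x | c ** x = x] = [set k *: c | k in [set: F]]].

Definition jordan : Prop :=
  forall x y, ((x ** x) ** y) ** x = (x ** x) ** (y ** x).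

End Algebras.

Arguments jordan {F} A.

Definition algebraic_closure (F E : fieldType) (iota : {rmorphism F -> E}) :
    Prop :=
  GRing.closed_field_axiom E /\ forall x : E, algebraicOver iota x.

(* Extension of scalars V (x)_F E along iota : F -> E. A finite formal sum of
   elementary tensors v (x) e is a sequence of pairs (e, v); two formal sums
   are identified when no iota-semilinear map g from V to an E-module W, with
   v (x) e sent to e *: g v, separates them. That this is the tensor product
   is scalext_universal below. *)
Section ScalarExtension.
Variables (F E : fieldType) (iota : {rmorphism F -> E}).

Definition semilin (V : lmodType F) (W : lmodType E) (g : V -> W) : Prop :=
  forall (k : F) u v, g (k *: u + v) = iota k *: g u + g v.

Section Module.
Variable V : lmodType F.

Definition tens_eval (W : lmodType E) (g : V -> W) (s : seq (E * V)) : W :=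
  \sum_(p <- s) p.1 *: g p.2.

Definition tens_rel (s t : seq (E * V)) : bool :=
  `[< forall (W : lmodType E) (g : V -> W),
        semilin g -> tens_eval g s = tens_eval g t >].

Fact tens_relP s t :
  reflect (forall (W : lmodType E) (g : V -> W),
             semilin g -> tens_eval g s = tens_eval g t) (tens_rel s t).
Proof. exact: asboolP. Qed.

Fact tens_rel_refl : reflexive tens_rel.
Proof. by move=> s; apply/tens_relP. Qed.

Fact tens_rel_sym : symmetric tens_rel.
Proof.
by move=> s t; apply/tens_relP/tens_relP => st W g gl; rewrite (st W g gl).
Qed.

Fact tens_rel_trans : transitive tens_rel.
Proof.
move=> t s u /tens_relP st /tens_relP tu; apply/tens_relP => W g gl.
by rewrite (st W g gl) (tu W g gl).
Qed.

Canonical tens_equiv := EquivRel tens_rel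
  tens_rel_refl tens_rel_sym tens_rel_trans.

Definition scalext := {eq_quot tens_equiv}.
HB.instance Definition _ := Choice.on scalext.
HB.instance Definition _ := EqQuotient.on scalext.

Lemma scalext_eqP (s t : seq (E * V)) :
  (\pi_scalext s = \pi_scalext t) <->
  (forall (W : lmodType E) (g : V -> W),
     semilin g -> tens_eval g s = tens_eval g t).
Proof.
split=> [/eqmodP/tens_relP //|st].
by apply/eqmodP/tens_relP.
Qed.

Lemma scalext_reprP (s : seq (E * V)) (W : lmodType E) (g : V -> W) :
  semilin g -> tens_eval g (repr (\pi_scalext s)) = tens_eval g s.
Proof. by apply: (scalext_eqP _ _).1; rewrite reprK. Qed.

Definition seq_scale (k : E) (s : seq (E * V)) := [seq (k * p.1, p.2) | p <- s].

Lemma tens_eval_cat (W : lmodType E) (g : V -> W) s t :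
  tens_eval g (s ++ t) = tens_eval g s + tens_eval g t.
Proof. exact: big_cat. Qed.

Lemma tens_eval_nil (W : lmodType E) (g : V -> W) : tens_eval g [::] = 0.
Proof. exact: big_nil. Qed.

Lemma tens_eval_scale (W : lmodType E) (g : V -> W) k s :
  tens_eval g (seq_scale k s) = k *: tens_eval g s.
Proof.
rewrite /tens_eval big_map scaler_sumr.
by apply: eq_bigr => p _; rewrite scalerA.
Qed.

Definition scalext_add (x y : scalext) := \pi_scalext (repr x ++ repr y).
Definition scalext_scale (k : E) (x : scalext) :=
  \pi_scalext (seq_scale k (repr x)).
Definition scalext_zero := \pi_scalext [::].
Definition scalext_opp (x : scalext) := scalext_scale (-1) x.

Local Ltac scalext_tac :=
  rewrite ?(tens_eval_cat, tens_eval_scale, tens_eval_nil, scalext_reprP) //.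

Fact scalext_addA : associative scalext_add.
Proof.
by move=> x y z; apply/scalext_eqP => W g gl; scalext_tac; rewrite addrA.
Qed.

Fact scalext_addC : commutative scalext_add.
Proof.
by move=> x y; apply/scalext_eqP => W g gl; scalext_tac; rewrite addrC.
Qed.

Fact scalext_add0 : left_id scalext_zero scalext_add.
Proof.
move=> x; rewrite -[RHS]reprK; apply/scalext_eqP => W g gl.
by scalext_tac; rewrite add0r.
Qed.

Fact scalext_addN : left_inverse scalext_zero scalext_opp scalext_add.
Proof.
move=> x; apply/scalext_eqP => W g gl.
by scalext_tac; rewrite scaleN1r addNr.
Qed.

HB.instance Definition _ := GRing.isZmodule.Build scalext
  scalext_addA scalext_addC scalext_add0 scalext_addN.

Fact scalext_scaleA a b v :
  scalext_scale a (scalext_scale b v) = scalext_scale (a * b) v.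
Proof.
by apply/scalext_eqP => W g gl; scalext_tac; rewrite scalerA.
Qed.

Fact scalext_scale1 : left_id 1 scalext_scale.
Proof.
move=> x; rewrite -[RHS]reprK; apply/scalext_eqP => W g gl.
by scalext_tac; rewrite scale1r.
Qed.

Fact scalext_scaleDr : right_distributive scalext_scale +%R.
Proof.
by move=> k x y; apply/scalext_eqP => W g gl; scalext_tac; rewrite scalerDr.
Qed.

Fact scalext_scaleDl v : {morph scalext_scale^~ v : a b / a + b}.
Proof.
by move=> k x; apply/scalext_eqP => W g gl; scalext_tac; rewrite scalerDl.
Qed.

HB.instance Definition _ := GRing.Zmodule_isLmodule.Build E scalext
  scalext_scaleA scalext_scale1 scalext_scaleDr scalext_scaleDl.

(* tens v is the tensor v (x) 1. *)
Definition tens (v : V) : scalext := \pi_scalext [:: (1, v)].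

Lemma scalext_addE (s t : seq (E * V)) :
  \pi_scalext (s ++ t) = \pi_scalext s + \pi_scalext t.
Proof. by apply/scalext_eqP => W g gl; scalext_tac. Qed.

Lemma scalext_scaleE k (s : seq (E * V)) :
  \pi_scalext (seq_scale k s) = k *: \pi_scalext s.
Proof. by apply/scalext_eqP => W g gl; scalext_tac. Qed.

Lemma tens_semilin : semilin tens.
Proof.
move=> k u v; rewrite /tens -scalext_scaleE -scalext_addE.
apply/scalext_eqP => W g gl; rewrite /tens_eval /= !big_cons !big_nil /= gl.
by rewrite mulr1 !scale1r !addr0.
Qed.

Lemma scalextE (s : seq (E * V)) :
  \pi_scalext s = \sum_(p <- s) p.1 *: tens p.2.
Proof.
elim: s => [|[k v] s IHs]; first by rewrite big_nil.
rewrite big_cons -cat1s scalext_addE IHs; congr (_ + _).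
by rewrite /tens -scalext_scaleE /seq_scale /= mulr1.
Qed.

Theorem scalext_universal (W : lmodType E) (g : V -> W) :
  semilin g ->
  exists! f : scalext -> W, linear f /\ forall v, f (tens v) = g v.
Proof.
move=> gl; exists (fun x => tens_eval g (repr x)); split.
  split=> [k x y|v]; first by scalext_tac.
  by rewrite scalext_reprP // /tens_eval big_seq1 scale1r.
move=> h [hl htens]; apply/funext => x; rewrite -[x in RHS]reprK scalextE.
rewrite /tens_eval; elim: (repr x) => [|p s IHs].
  by rewrite !big_nil; have := hl (-1) 0 0; rewrite !scaleN1r !addNr.
by rewrite !big_cons hl htens IHs.
Qed.

End Module.

Section Product.
Variable A : comAlg F.
Local Notation AE := (scalext A).

Definition seq_mul (s t : seq (E * A)) : seq (E * A) :=
  [seq (p.1 * q.1, p.2 ** q.2) | p <- s, q <- t].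

Definition scalext_mul (x y : AE) : AE :=
  \pi_(scalext A) (seq_mul (repr x) (repr y)).

Lemma tens_eval_mul (W : lmodType E) (g : A -> W) s t :
  tens_eval g (seq_mul s t) =
  tens_eval (fun u => tens_eval (fun v => g (u ** v)) t) s.
Proof.
rewrite /tens_eval /seq_mul big_allpairs_dep /=; apply: eq_bigr => p _.
by rewrite scaler_sumr; apply: eq_bigr => q _; rewrite scalerA.
Qed.

Lemma tens_eval_mulC (W : lmodType E) (g : A -> W) s t :
  tens_eval g (seq_mul s t) = tens_eval g (seq_mul t s).
Proof.
rewrite !tens_eval_mul /tens_eval.
under eq_bigr => p _ do rewrite scaler_sumr.
under [RHS]eq_bigr => p _ do rewrite scaler_sumr.
rewrite exchange_big /=; apply: eq_bigr => p _; apply: eq_bigr => q _.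
by rewrite !scalerA mulrC amulC.
Qed.

Lemma semilin_mul (W : lmodType E) (g : A -> W) u :
  semilin g -> semilin (fun v => g (u ** v)).
Proof. by move=> gl k v w; rewrite amul_linear gl. Qed.

Lemma semilin_eval (W : lmodType E) (g : A -> W) t :
  semilin g -> semilin (fun u => tens_eval (fun v => g (u ** v)) t).
Proof.
move=> gl k u v; rewrite /tens_eval scaler_sumr -big_split /=.
apply: eq_bigr => p _.
rewrite amulC amul_linear gl scalerDr !scalerA mulrC.
by rewrite [p.2 ** u]amulC [p.2 ** v]amulC.
Qed.

Lemma scalext_mulE (s t : seq (E * A)) :
  scalext_mul (\pi_(scalext A) s) (\pi_(scalext A) t) =
  \pi_(scalext A) (seq_mul s t).
Proof.
apply/scalext_eqP => W g gl.
rewrite tens_eval_mul scalext_reprP; last exact: semilin_eval.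
rewrite -tens_eval_mul tens_eval_mulC tens_eval_mul scalext_reprP.
  by rewrite -tens_eval_mul tens_eval_mulC.
exact: semilin_eval.
Qed.

Fact scalext_mulC : commutative scalext_mul.
Proof. by move=> x y; apply/scalext_eqP => W g gl; rewrite tens_eval_mulC. Qed.

Fact scalext_mul_linear (x : AE) : linear (scalext_mul x).
Proof.
move=> k y z; rewrite -[x]reprK -[y]reprK -[z]reprK.
rewrite -scalext_scaleE -scalext_addE !scalext_mulE.
rewrite -scalext_scaleE -scalext_addE.
apply/scalext_eqP => W g gl.
rewrite tens_eval_mulC tens_eval_mul !(tens_eval_cat, tens_eval_scale).
by rewrite -!tens_eval_mul; congr (_ *: _ + _); apply: tens_eval_mulC.
Qed.

(* A (x)_F E with (u (x) e) ** (v (x) e') = (u ** v) (x) (e * e'). *)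
Definition scalext_alg : comAlg E := ComAlg scalext_mulC scalext_mul_linear.

Lemma tens_mul (u v : A) :
  (tens u : scalext_alg) ** tens v = tens (u ** v) :> scalext_alg.
Proof. by rewrite /amul /= scalext_mulE /seq_mul /= mulr1. Qed.

(* B (x)_F E for a subspace B of A, identified (E being flat over F) with the
   E-span of B in A (x)_F E. *)
Definition scalext_sub (B : set A) : set scalext_alg :=
  linear_span ((@tens A : A -> scalext_alg) @` B).

(* Solidity of the subalgebra generated by a and b, for iota an algebraic
   closure. *)
Definition solid (a b : A) : Prop :=
  forall c : scalext_alg,
    primitive_idempotent_in
      (scalext_sub (generated_subalgebra [set a; b])) c ->
    J_half_axis c.

End Product.
End ScalarExtension.

(* Main.v *)
Require Import Defs.
From mathcomp Require Import all_boot all_order all_algebra.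
From mathcomp Require Import boolp classical_sets.
From mathcomp Require Import ring.

(* Write [D(x,y,z) = [L_xy, L_z] + [L_yz, L_x] + [L_zx, L_y]]; away from
   characteristic 3, [A] is Jordan iff [D = 0].

   If [A] is Jordan, [D = 0] extends by multilinearity to [A_E], where it
   yields the Peirce decomposition of every idempotent.

   Conversely, write [b = k a + w + b0] along the eigenspaces of the axis [a].
   The primitive idempotents of [<<a, b>>] over [E] contain a conic through
   [a] with tangent [w]; if these are axes, differentiating their Miyamoto
   involutions at [a] shows that [[L_a, L_w] = [L_a, L_b]] is a derivation [d].
   Since [L_a] commutes with [L_u] for [u] in [A_0(a)], applying [d] to
   [[L_a, L_u] = 0] gives [D(a, u, w) = 0], the only component of [D(a, -, -)]
   that does not vanish for every axis. If the axes span, then [D = 0], so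
   [x |-> [L_xx, L_x]] is additive and zero on axes, hence zero in every
   characteristic. If they only generate, the obstruction to [[L_ab, L_c]]
   being a derivation is symmetric in [a, b, c] while its cyclic sum is that
   of [D(a, b, c) = 0]; so 3 times it vanishes, and the hypothesis passes to
   the spanning closure of [X] under Miyamoto involutions. *)

Local Open Scope ring_scope.
Local Open Scope classical_set_scope.

Set Implicit Arguments.
Unset Strict Implicit.
Unset Printing Implicit Defensive.

Import GRing.Theory.

(** * Separation of vectors by linear forms *)

Section Separation.
Variables (K : fieldType) (V : lmodType K).

Definition lin_form (l : V -> K) : Prop :=
  forall (k : K) u v, l (k *: u + v) = k * l u + l v.

(** A subspace [U] maximal among those missing [v] is a complement of the line of [v]; [l x] is the
    scalar that puts [x - l x v] in [U]. *)
Lemma exists_lin_form (v : V) : v != 0 -> exists2 l, lin_form l & l v = 1.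
Proof.
move=> v0.
(* [P] does not ask for [0], so that the union of the empty chain satisfies it; [U 0] comes from
   maximality. *)
pose P (U : set V) :=
  (forall (k : K) x y, U x -> U y -> U (k *: x + y)) /\ ~ U v.
have [U [[Ulin Uv] Umax]] : exists U, P U /\ forall W, U `<` W -> ~ P W.
  apply: Zorn_bigcup => C CP Ctot; split; last by move=> [U /CP[_ Uv]].
  move=> k x y [U1 CU1 U1x] [U2 CU2 U2y].
  have [le12|le21] := Ctot _ _ CU1 CU2.
    by exists U2 => //; apply: (CP _ CU2).1 => //; apply: le12.
  by exists U1 => //; apply: (CP _ CU1).1 => //; apply: le21.
have U0 : U 0.
  have [[u Uu]|Ue] := pselect (exists u, U u).
    by have := Ulin (-1) _ _ Uu Uu; rewrite scaleN1r addNr.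
  exfalso; apply: (Umax [set 0]).
    split; first by move=> x Ux; case: Ue; exists x.
    by move=> /(_ 0 erefl) U0; case: Ue; exists 0.
  by split=> [k x y -> ->|/= /eqP]; [rewrite scaler0 addr0 | rewrite (negbTE v0)].
have UZ k x : U x -> U (k *: x) by move=> Ux; rewrite -[_ *: _]addr0; apply: Ulin.
have UB x y : U x -> U y -> U (x - y).
  by move=> Ux Uy; rewrite addrC -scaleN1r; apply: Ulin.
have dec x : exists k, U (x - k *: v).
  have [Ux|Ux] := pselect (U x); first by exists 0; rewrite scale0r subr0.
  (* [W] is [U + K x], so maximality puts [v] in it. *)
  pose W := [set y | exists k, U (y - k *: x)].
  have [k Uk] : W v.
    apply: contrapT => Wv; apply: (Umax W).
      split=> [y Uy|WU]; first by exists 0; rewrite scale0r subr0.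
      by apply: Ux; apply: WU; exists 1; rewrite scale1r subrr.
    split=> // k y z [i Ui] [j Uj]; exists (k * i + j).
    have -> : k *: y + z - (k * i + j) *: x = k *: (y - i *: x) + (z - j *: x).
      by rewrite scalerBr scalerDl scalerA opprD addrACA.
    exact: Ulin.
  have k0 : k != 0.
    by apply/eqP => k0; apply: Uv; move: Uk; rewrite k0 scale0r subr0.
  exists k^-1.
  suff -> : x - k^-1 *: v = - k^-1 *: (v - k *: x) by apply: UZ.
  by rewrite scalerBr scalerA mulNr mulVf // scaleNr scaleN1r opprK addrC.
have [l lP] := choice dec.
have l_uniq x k : U (x - k *: v) -> l x = k.
  move=> Uk; apply/eqP; rewrite -subr_eq0; apply/eqP.
  have := UB _ _ Uk (lP x); rewrite opprB addrC addrA subrK -scalerBl => Ulk.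
  apply: contrapT => /eqP lk; apply: Uv.
  by rewrite -[v]scale1r -(mulVf lk) -scalerA; apply: UZ.
exists l => [k x y|]; apply: l_uniq; last by rewrite scale1r subrr.
have -> : k *: x + y - (k * l x + l y) *: v = k *: (x - l x *: v) + (y - l y *: v).
  by rewrite scalerBr scalerDl scalerA opprD addrACA.
exact: Ulin.
Qed.

(** Turns a vector identity into a scalar one, where [ring] and [field] apply; [module_ring] and
    [module_field] rest on it. *)
Lemma lin_form_eq (x y : V) :
  (forall l : V -> K, {morph l : u v / u + v >-> u + v} ->
    (forall k u, l (k *: u) = k * l u) -> {morph l : u / - u >-> - u} ->
    l 0 = 0 -> l x = l y) -> x = y.
Proof.
move=> lxy; apply: contrapT => /eqP; rewrite -subr_eq0 => /exists_lin_form[l ll l1].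
have l0 : l 0 = 0.
  have := ll (-1) 0 0; rewrite scaleN1r addNr => ->.
  by rewrite mulN1r addNr.
have lD : {morph l : u v / u + v >-> u + v}.
  by move=> u v; have := ll 1 u v; rewrite scale1r mul1r.
have lZ k u : l (k *: u) = k * l u by rewrite -[k *: u]addr0 ll l0 addr0.
have lN : {morph l : u / - u >-> - u} by move=> u; rewrite -scaleN1r lZ mulN1r.
by have /eqP := l1; rewrite lD lN (lxy l) // subrr eq_sym oner_eq0.
Qed.

End Separation.

Ltac lin_form_intro :=
  let l := fresh "l" in let lD := fresh "lD" in let lZ := fresh "lZ" in
  let lN := fresh "lN" in let l0 := fresh "l0" in
  apply: lin_form_eq => l lD lZ lN l0; rewrite ?(lD, lZ, lN, l0).
Ltac module_ring := lin_form_intro; ring.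
Ltac module_field := lin_form_intro; field; by [].

(** * Bilinearity of the product *)

Section Bilinear.
Variables (F : fieldType) (A : comAlg F).
Implicit Types (x y z : A).

Lemma amulDr x y z : x ** (y + z) = x ** y + x ** z.
Proof. by have := amul_linear x 1 y z; rewrite !scale1r. Qed.
Lemma amul0r x : x ** 0 = 0.
Proof. by apply: (addrI (x ** 0)); rewrite -amulDr !addr0. Qed.
Lemma amulZr k x y : x ** (k *: y) = k *: (x ** y).
Proof. by have := amul_linear x k y 0; rewrite amul0r !addr0. Qed.
Lemma amulNr x y : x ** (- y) = - (x ** y).
Proof. by rewrite -scaleN1r amulZr scaleN1r. Qed.
Lemma amulDl x y z : (y + z) ** x = y ** x + z ** x.
Proof. by rewrite ![_ ** x]amulC amulDr. Qed.
Lemma amul0l x : 0 ** x = 0.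
Proof. by rewrite amulC amul0r. Qed.
Lemma amulZl k x y : (k *: y) ** x = k *: (y ** x).
Proof. by rewrite ![_ ** x]amulC amulZr. Qed.
Lemma amulNl x y : (- y) ** x = - (y ** x).
Proof. by rewrite ![_ ** x]amulC amulNr. Qed.

Definition amulE :=
  (amulDr, amulDl, amulZr, amulZl, amulNr, amulNl, amul0r, amul0l).

End Bilinear.

(** * Peirce decomposition, fusion rules and Miyamoto involutions *)

Section Axes.
Variables (F : fieldType) (A : comAlg F).
Hypothesis two_neq0 : (2%:R : F) != 0.
Implicit Types (a b c x y z w : A).
Local Notation h := (2%:R^-1 : F).

(** Equational form of the axis conditions: in [peircehh], membership of [z] in [A_1 + A_0] is
    encoded as [a (a z) = a z]. *)
Record peirce a : Prop := Peirce {
  peirce_idem : a ** a = a;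
  peirce_dec : forall x, exists x1 x0 xh,
    [/\ a ** x1 = x1, a ** x0 = 0, a ** xh = h *: xh & x = x1 + x0 + xh];
  peirce11 : forall x y, a ** x = x -> a ** y = y -> a ** (x ** y) = x ** y;
  peirce00 : forall x y, a ** x = 0 -> a ** y = 0 -> a ** (x ** y) = 0;
  peirce10 : forall x y, a ** x = x -> a ** y = 0 -> x ** y = 0;
  peirce1h : forall x y,
    a ** x = x -> a ** y = h *: y -> a ** (x ** y) = h *: (x ** y);
  peirce0h : forall x y,
    a ** x = 0 -> a ** y = h *: y -> a ** (x ** y) = h *: (x ** y);
  peircehh : forall x y, a ** x = h *: x -> a ** y = h *: y ->
    a ** (a ** (x ** y)) = a ** (x ** y)
}.

Lemma eigspace1 a x : eigspace 1 a x <-> a ** x = x.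
Proof. by rewrite /eigspace /= scale1r. Qed.

Lemma eigspace0 a x : eigspace 0 a x <-> a ** x = 0.
Proof. by rewrite /eigspace /= scale0r. Qed.

Lemma J_half_axisP a : J_half_axis a <-> a <> 0 /\ peirce a.
Proof.
split=> [[a0 ida [dec uniq] [e11 e00 e10 e1h [e0h ehh]]]|[a0 pa]].
  split=> //; split=> //.
  - move=> x; have [x1 [x0 [xh [/eigspace1 ? /eigspace0 ? ? ?]]]] := dec x.
    by exists x1, x0, xh.
  - by move=> x y /eigspace1 ax /eigspace1 ay; apply/eigspace1; apply: e11.
  - by move=> x y /eigspace0 ax /eigspace0 ay; apply/eigspace0; apply: e00.
  - by move=> x y /eigspace1 ax /eigspace0 ay; apply: e10.
  - by move=> x y /eigspace1 ax; apply: e1h.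
  - by move=> x y /eigspace0 ax; apply: e0h.
  - move=> x y ax ay.
    have [u1 [u0 [/eigspace1 au1 /eigspace0 au0 ->]]] := ehh _ _ ax ay.
    by rewrite amulDr au1 au0 addr0.
split=> //; first exact: peirce_idem pa.
- split=> [x|x1 x0 xh /eigspace1 a1 /eigspace0 a_0 ah x_0].
    have [x1 [x0 [xh [? ? ? ?]]]] := peirce_dec pa x.
    by exists x1, x0, xh; split=> //; [apply/eigspace1 | apply/eigspace0].
  have eq1 : a ** (x1 + x0 + xh) = 0 by rewrite x_0 amul0r.
  have eq2 : a ** (a ** (x1 + x0 + xh)) = 0 by rewrite x_0 !amul0r.
  move: eq1 eq2; rewrite !amulE a1 a_0 ah !amulE a1 ah => eq1 eq2.
  (* [4 (L_a - L_a^2)] kills [A_1] and [A_0] and is the identity on [A_{1/2}]. *)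
  have xh0 : xh = 0.
    transitivity (4%:R *: (x1 + 0 + h *: xh) - 4%:R *: (x1 + 0 + h *: (h *: xh))).
      by module_field.
    by rewrite eq1 eq2 !scaler0 subr0.
  move: x_0 eq1; rewrite xh0 scaler0 !addr0 => x_0 x10; split=> //.
  by move: x_0; rewrite x10 add0r.
- split.
  + by move=> x y /eigspace1 ax /eigspace1 ay; apply/eigspace1;
      apply: peirce11 pa _ _ _ _.
  + by move=> x y /eigspace0 ax /eigspace0 ay; apply/eigspace0;
      apply: peirce00 pa _ _ _ _.
  + by move=> x y /eigspace1 ax /eigspace0 ay; apply: peirce10 pa _ _ ax ay.
  + by move=> x y /eigspace1 ax; apply: peirce1h pa _ _ ax.
  + split; first by move=> x y /eigspace0 ax; apply: peirce0h pa _ _ ax.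
    move=> x y ax ay; exists (a ** (x ** y)), (x ** y - a ** (x ** y)); split.
    * by apply/eigspace1; apply: peircehh pa _ _ ax ay.
    * by apply/eigspace0; rewrite amulDr amulNr (peircehh pa ax ay) subrr.
    * by rewrite addrC subrK.
Qed.

(** The Miyamoto involution as a polynomial in [L_a]: [1 - 8 t + 8 t^2] is [1] at [t = 0, 1] and
    [-1] at [t = 1/2]. *)
Definition tau a x := x - 8%:R *: (a ** x) + 8%:R *: (a ** (a ** x)).

Section OneAxis.
Variable a : A.
Hypothesis pa : peirce a.

Lemma peirce_grading x : exists e o,
  [/\ a ** (a ** e) = a ** e, a ** o = h *: o & x = e + o].
Proof.
have [x1 [x0 [xh [a1 a0 ah ->]]]] := peirce_dec pa x.
by exists (x1 + x0), xh; split=> //; rewrite !amulE a1 a0 !amulE a1.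
Qed.

Lemma even_split e : a ** (a ** e) = a ** e ->
  exists e1 e0, [/\ a ** e1 = e1, a ** e0 = 0 & e = e1 + e0].
Proof.
move=> ae; exists (a ** e), (e - a ** e); split=> //; last by rewrite addrC subrK.
by rewrite !amulE ae subrr.
Qed.

Lemma even_even e e' : a ** (a ** e) = a ** e -> a ** (a ** e') = a ** e' ->
  a ** (a ** (e ** e')) = a ** (e ** e').
Proof.
move=> /even_split[e1 [e0 [a1 a0 ->]]] /even_split[f1 [f0 [b1 b0 ->]]].
rewrite !amulE (peirce10 pa a1 b0) [e0 ** f1]amulC (peirce10 pa b1 a0) !amulE.
by rewrite (peirce11 pa a1 b1) (peirce00 pa a0 b0) !amulE (peirce11 pa a1 b1).
Qed.

Lemma even_odd e o : a ** (a ** e) = a ** e -> a ** o = h *: o ->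
  a ** (e ** o) = h *: (e ** o).
Proof.
move=> /even_split[e1 [e0 [a1 a0 ->]]] ao.
by rewrite !amulE (peirce1h pa a1 ao) (peirce0h pa a0 ao) scalerDr.
Qed.

Lemma tau_even e : a ** (a ** e) = a ** e -> tau a e = e.
Proof. by rewrite /tau => ->; rewrite subrK. Qed.

Lemma tau_odd o : a ** o = h *: o -> tau a o = - o.
Proof. by rewrite /tau => ao; rewrite !(ao, amulE); module_field. Qed.

Lemma tau_lin k x y : tau a (k *: x + y) = k *: tau a x + tau a y.
Proof. by rewrite /tau !amulE; module_ring. Qed.

Lemma tauD x y : tau a (x + y) = tau a x + tau a y.
Proof. by rewrite -[x]scale1r tau_lin !scale1r. Qed.

(** The fusion rules make [(A_1 + A_0) + A_{1/2}] a Z/2-grading, of which [tau a] is the sign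
    automorphism. *)
Lemma tau_mul x y : tau a (x ** y) = tau a x ** tau a y.
Proof.
have [e [o [ae ao ->]]] := peirce_grading x.
have [f [p [af ap ->]]] := peirce_grading y.
rewrite [tau a (e + o)]tauD [tau a (f + p)]tauD.
rewrite (tau_even ae) (tau_even af) (tau_odd ao) (tau_odd ap) !amulE !tauD.
rewrite (tau_even (even_even ae af)) (tau_even (peircehh pa ao ap)).
rewrite (tau_odd (even_odd ae ap)) [o ** f]amulC (tau_odd (even_odd af ao)).
by module_ring.
Qed.

Lemma tauK x : tau a (tau a x) = x.
Proof.
have [e [o [ae ao ->]]] := peirce_grading x.
rewrite tauD (tau_even ae) (tau_odd ao) tauD (tau_even ae) tau_odd ?opprK //.
by rewrite amulNr ao scalerN.
Qed.

(** [L_u] preserves [A_0(a)] and [A_{1/2}(a)] and kills [A_1(a)], hence commutes with [L_a]. *)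
Lemma seress0 u z : a ** u = 0 -> a ** (u ** z) = u ** (a ** z).
Proof.
move=> au; have [z1 [z0 [zh [a1 a0 ah ->]]]] := peirce_dec pa z.
rewrite !amulE a1 a0 ah !amulE (peirce00 pa au a0) (peirce0h pa au ah).
by rewrite [u ** z1]amulC (peirce10 pa a1 au) !amulE.
Qed.

Lemma seress1 u z : a ** u = u -> a ** (u ** z) = u ** (a ** z).
Proof.
move=> au; have [z1 [z0 [zh [a1 a0 ah ->]]]] := peirce_dec pa z.
rewrite !amulE a1 a0 ah !amulE (peirce11 pa au a1) (peirce1h pa au ah).
by rewrite (peirce10 pa au a0) !amulE.
Qed.

Lemma seress_even e z : a ** (a ** e) = a ** e -> a ** (e ** z) = e ** (a ** z).
Proof.
move=> /even_split[e1 [e0 [a1 a0 ->]]].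
by rewrite !amulE (seress1 _ a1) (seress0 _ a0).
Qed.

End OneAxis.

(** * Commutators of multiplications and the operator [D] *)

Definition bra x y z := x ** (y ** z) - y ** (x ** z).

Definition derpair x y := forall z w,
  bra x y (z ** w) = bra x y z ** w + z ** bra x y w.

(** [D(x, y, z)] applied to [w], with [bra x y] for [[L_x, L_y]]; [2 D] is the full polarization of
    [[L_xx, L_x]]. *)
Definition jdef x y z w :=
  bra (x ** y) z w + bra (y ** z) x w + bra (z ** x) y w.

Lemma braC x y z : bra x y z = - bra y x z.
Proof. by rewrite /bra opprB. Qed.
Lemma braDl x x' y z : bra (x + x') y z = bra x y z + bra x' y z.
Proof. by rewrite /bra !amulE; module_ring. Qed.
Lemma braZl k x y z : bra (k *: x) y z = k *: bra x y z.
Proof. by rewrite /bra !amulE; module_ring. Qed.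
Lemma bra0l y z : bra 0 y z = 0.
Proof. by rewrite /bra !amulE subrr. Qed.
Lemma braDr x y y' z : bra x (y + y') z = bra x y z + bra x y' z.
Proof. by rewrite /bra !amulE; module_ring. Qed.
Lemma braZr k x y z : bra x (k *: y) z = k *: bra x y z.
Proof. by rewrite /bra !amulE; module_ring. Qed.
Lemma braxx x z : bra x x z = 0.
Proof. by rewrite /bra subrr. Qed.

Lemma jdefC x y z w : jdef x y z w = jdef x z y w.
Proof.
rewrite /jdef [x ** y]amulC [z ** y]amulC [z ** x]amulC; module_ring.
Qed.
Lemma jdef_rot x y z w : jdef x y z w = jdef y z x w.
Proof. by rewrite /jdef; module_ring. Qed.
Lemma jdefDl x x' y z w : jdef (x + x') y z w = jdef x y z w + jdef x' y z w.
Proof. by rewrite /jdef /bra !amulE; module_ring. Qed.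
Lemma jdefZl k x y z w : jdef (k *: x) y z w = k *: jdef x y z w.
Proof. by rewrite /jdef /bra !amulE; module_ring. Qed.
Lemma jdefDm x y y' z w : jdef x (y + y') z w = jdef x y z w + jdef x y' z w.
Proof. by rewrite jdef_rot jdefDl -!(jdef_rot x). Qed.
Lemma jdefZm k x y z w : jdef x (k *: y) z w = k *: jdef x y z w.
Proof. by rewrite jdef_rot jdefZl -(jdef_rot x). Qed.
Lemma jdefDr x y z z' w : jdef x y (z + z') w = jdef x y z w + jdef x y z' w.
Proof. by rewrite jdefC jdefDm ![jdef x _ y w]jdefC. Qed.
Lemma jdefZr k x y z w : jdef x y (k *: z) w = k *: jdef x y z w.
Proof. by rewrite jdefC jdefZm [jdef x _ y w]jdefC. Qed.

Lemma bra_even a e w : peirce a -> a ** (a ** e) = a ** e -> bra a e w = 0.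
Proof. by move=> pa ae; rewrite /bra (seress_even pa _ ae) subrr. Qed.

(* On the [i]-eigenspace of [a], [jdef a a y] is [(1 - 2 i) [L_a, L_y]]. *)
Lemma jdef_axis2 a y w : peirce a -> jdef a a y w = 0.
Proof.
move=> pa; have [y1 [y0 [yh [a1 a0 ah ->]]]] := peirce_dec pa y.
rewrite !jdefDr /jdef (peirce_idem pa) ![_ ** a]amulC a1 a0 ah !bra0l.
rewrite !braZl [bra y1 a w]braC [bra yh a w]braC.
rewrite (bra_even _ pa (e := y1)) ?a1 //.
rewrite (bra_even _ pa (e := y0)) ?a0 ?amul0r //.
by module_field.
Qed.

Lemma jdef_00 a x y w : peirce a -> a ** x = 0 -> a ** y = 0 -> jdef a x y w = 0.
Proof.
move=> pa ax ay; rewrite /jdef ax [y ** a]amulC ay !bra0l braC.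
by rewrite (bra_even _ pa) ?oppr0 ?addr0 // (peirce00 pa ax ay) amul0r.
Qed.

(** The outer terms [[L_x, L_y] / 2] and [[L_y, L_x] / 2] cancel, and [L_a] commutes with [L_xy]
    since [x y] is even. *)
Lemma jdef_hh a x y w :
  peirce a -> a ** x = h *: x -> a ** y = h *: y -> jdef a x y w = 0.
Proof.
move=> pa ax ay; rewrite /jdef ax [y ** a]amulC ay !braZl [bra _ a w]braC.
rewrite (bra_even _ pa (peircehh pa ax ay)) [bra y x w]braC; module_ring.
Qed.

(* The derivation [bra a y] kills [[L_a, L_x]], which is zero. *)
Lemma jdef_0h a x y w : peirce a ->
  a ** x = 0 -> a ** y = h *: y -> derpair a y -> jdef a x y w = 0.
Proof.
move=> pa ax ay day.
have eq1 : bra a y (a ** (x ** w)) = bra a y (x ** (a ** w)) by rewrite (seress0 pa).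
have da : bra a y a = - (h * h) *: y.
  by rewrite /bra (peirce_idem pa) [y ** a]amulC ay !amulE ay; module_field.
have dx : bra a y x = h *: (x ** y).
  by rewrite /bra ax !amulE [y ** x]amulC (peirce0h pa ax ay) subr0.
move: eq1; rewrite (day a) (day x (a ** w)) (day x w) (day a w) da dx.
rewrite [a ** (_ + _)]amulDr [x ** (_ + _)]amulDr (seress0 pa _ ax) => eq1.
rewrite /jdef ax [y ** a]amulC ay bra0l add0r braZl /bra.
(* Both sides of [eq1] contain [x (a (bra a y w))]; twice the difference of the other terms is
   [D(a, x, y) w]. *)
set d := x ** (a ** _) in eq1.
transitivity (2%:R *: ((h *: (x ** y)) ** (a ** w) +
    (x ** ((- (h * h) *: y) ** w) + d) - ((- (h * h) *: y) ** (x ** w) +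
    (a ** ((h *: (x ** y)) ** w) + d)))).
  by rewrite !amulE; module_field.
by rewrite eq1 subrr scaler0.
Qed.

End Axes.

(** * Primitive axes whose commutators [[L_a, L_b]] are derivations *)

Section PrimitiveAxes.
Variables (F : fieldType) (A : comAlg F).
Hypothesis two_neq0 : (2%:R : F) != 0.
Implicit Types (a b c x y z w : A).
Local Notation h := (2%:R^-1 : F).

Definition prim a :=
  [/\ a <> 0, peirce a & forall x, a ** x = x -> exists k, x = k *: a].

Lemma primP a : primitive_J_half_axis a <-> prim a.
Proof.
split=> [[/(J_half_axisP two_neq0)[a0 pa] a1]|[a0 pa a1]].
  split=> // x ax; have : eigspace 1 a x by apply/eigspace1.
  by rewrite a1 => -[k _ <-]; exists k.
split; first by apply/(J_half_axisP two_neq0).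
apply/seteqP; split=> x; first by move/eigspace1/a1 => [k ->]; exists k.
by move=> [k _ <-]; apply/eigspace1; rewrite amulZr (peirce_idem pa).
Qed.

Lemma prim_dec a x : prim a -> exists k x0 xh,
  [/\ a ** x0 = 0, a ** xh = h *: xh & x = k *: a + x0 + xh].
Proof.
move=> [_ pa a1]; have [x1 [x0 [xh [/a1[k ->] ? ? ->]]]] := peirce_dec pa x.
by exists k, x0, xh.
Qed.

Lemma prim_uniq a k x0 xh : prim a -> a ** x0 = 0 -> a ** xh = h *: xh ->
  k *: a + x0 + xh = 0 -> [/\ k = 0, x0 = 0 & xh = 0].
Proof.
move=> [a0 pa _] ax0 axh e.
have [_ _ [_ uniq] _] : J_half_axis a by apply/(J_half_axisP two_neq0).
have [||//|/eqP ka -> ->] := uniq (k *: a) x0 xh _ _ _ e.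
- by apply/eigspace1; rewrite amulZr (peirce_idem pa).
- exact/eigspace0.
split=> //; apply/eqP; move: ka; rewrite scaler_eq0.
by move=> /orP[//|/eqP].
Qed.

Lemma derpair_lin x y z k :
  derpair x y -> derpair x z -> derpair x (k *: y + z).
Proof.
move=> dy dz u v; rewrite !braDr !braZr dy dz !amulE; module_ring.
Qed.

Lemma derpairC x y : derpair x y -> derpair y x.
Proof.
by move=> d u v; rewrite ![bra y x _]braC d !amulE; module_ring.
Qed.

(** [L_a] commutes with [L_a] and [L_x0], so only [xh] contributes to the commutator. *)
Lemma derpair_half a k x0 xh : prim a -> a ** x0 = 0 ->
  derpair a (k *: a + x0 + xh) -> derpair a xh.
Proof.
move=> [_ pa _] ax d.
suff e u : bra a xh u = bra a (k *: a + x0 + xh) u by move=> u v; rewrite !e d.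
rewrite !braDr braZr braxx scaler0 add0r.
by rewrite (bra_even _ pa (e := x0)) ?add0r // ax amul0r.
Qed.

(** Expand [x] and [y] along the eigenspaces of [a]: only the mixed [A_0], [A_{1/2}] terms call on
    the derivations, through [jdef_0h]. *)
Lemma jdef_axis a x y w : prim a -> derpair a x -> derpair a y ->
  jdef a x y w = 0.
Proof.
move=> qa; have [_ pa _] := qa.
have [k [x0 [xh [ax0 axh ->]]]] := prim_dec x qa.
have [l [y0 [yh [ay0 ayh ->]]]] := prim_dec y qa.
move=> /(derpair_half qa ax0) dx /(derpair_half qa ay0) dy.
have jaa u : jdef a a u w = 0 by apply: jdef_axis2.
have jaa' u : jdef a u a w = 0 by rewrite jdefC jaa.
rewrite !(jdefDm, jdefDr, jdefZm, jdefZr, jaa, jaa').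
rewrite (jdef_00 _ pa ax0 ay0) (jdef_hh _ pa axh ayh).
rewrite (jdef_0h two_neq0 _ pa ax0 ayh dy) [jdef a xh y0 w]jdefC.
by rewrite (jdef_0h two_neq0 _ pa ay0 axh dx) !scaler0 !addr0.
Qed.

Lemma linear_span_all (S U : set A) : linear_span S = [set: A] -> U 0 ->
  (forall (k : F) u v, U u -> U v -> U (k *: u + v)) -> S `<=` U ->
  forall x, U x.
Proof.
move=> spanS U0 Ul SU x; have : [set: A] x by [].
by rewrite -spanS; apply.
Qed.

(** Since [D(x, x, x) = 3 [L_xx, L_x]], deducing the cubic identity from [D = 0] directly would
    divide by 3. A second induction along the span avoids this: the mixed terms of the cubic are
    values of [D]. *)
Lemma jordan_of_span (Y : set A) :
  (forall a, Y a -> prim a) -> (forall a b, Y a -> Y b -> derpair a b) ->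
  linear_span Y = [set: A] -> jordan A.
Proof.
move=> Yprim Yder Yspan.
have der0 a : derpair a 0 by move=> u v; rewrite /bra !amulE; module_ring.
have dera a : Y a -> forall y, derpair a y.
  move=> Ya; apply: (linear_span_all Yspan (der0 a)) => [k u v|b Yb].
    exact: derpair_lin.
  exact: Yder.
have jdef0 x : forall y z w, jdef x y z w = 0.
  move: x; apply: (linear_span_all Yspan) => [y z w|k u v ju jv y z w|a Ya y z w].
  - by rewrite /jdef /bra !amulE; module_ring.
  - by rewrite jdefDl jdefZl ju jv scaler0 addr0.
  - by apply: jdef_axis; [exact: Yprim | exact: dera | exact: dera].
suff cubic x : forall y, bra (x ** x) x y = 0.
  move=> x y; have /eqP := cubic x y; rewrite /bra subr_eq0 => /eqP.
  by rewrite [y ** x]amulC [_ ** y ** x]amulC => ->.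
move: x; apply: (linear_span_all Yspan) => [y|k u v cu cv y|a Ya y].
- by rewrite amul0r bra0l.
- transitivity (k ^+ 3 *: bra (u ** u) u y + k ^+ 2 *: jdef u u v y +
    k *: jdef u v v y + bra (v ** v) v y).
    rewrite /jdef /bra !amulE [v ** u]amulC; module_ring.
  by rewrite cu cv !jdef0 !scaler0 !addr0.
- by have [_ pa _] := Yprim a Ya; rewrite (peirce_idem pa) braxx.
Qed.

Definition derdef x y z w := bra x y (z ** w) - bra x y z ** w - z ** bra x y w.

Lemma derdef0 x y z w : derpair x y -> derdef x y z w = 0.
Proof. by move=> d; rewrite /derdef d addrAC addrK subrr. Qed.

Lemma derdefDl x x' y z w : derdef (x + x') y z w = derdef x y z w + derdef x' y z w.
Proof. by rewrite /derdef !braDl !amulE; module_ring. Qed.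
Lemma derdefZl k x y z w : derdef (k *: x) y z w = k *: derdef x y z w.
Proof. by rewrite /derdef !braZl !amulE; module_ring. Qed.
Lemma derdefC x y z w : derdef x y z w = - derdef y x z w.
Proof. by rewrite /derdef ![bra x y _]braC !amulE; module_ring. Qed.
Lemma derdefDr x y y' z w : derdef x (y + y') z w = derdef x y z w + derdef x y' z w.
Proof. by rewrite derdefC derdefDl opprD -!derdefC. Qed.
Lemma derdefZr k x y z w : derdef x (k *: y) z w = k *: derdef x y z w.
Proof. by rewrite derdefC derdefZl -scalerN -derdefC. Qed.

Lemma tauN a x : tau a (- x) = - tau a x.
Proof. by rewrite /tau !amulE; module_ring. Qed.

Lemma tau_bra a x y z : peirce a ->
  tau a (bra x y z) = bra (tau a x) (tau a y) (tau a z).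
Proof.
by move=> pa; rewrite /bra tauD tauN !(tau_mul two_neq0 pa).
Qed.

Lemma tau_derdef a x y z w : peirce a ->
  tau a (derdef x y z w) = derdef (tau a x) (tau a y) (tau a z) (tau a w).
Proof.
move=> pa; rewrite {1}/derdef !tauD !tauN !(tau_mul two_neq0 pa).
by rewrite !(tau_bra _ _ _ pa) ?(tau_mul two_neq0 pa).
Qed.

Lemma commutator_der (d e : A -> A) (k : F) :
  {morph d : u v / u + v} -> {morph e : u v / u + v} ->
  (forall u v, d (u ** v) = d u ** v + u ** d v) ->
  (forall u v, e (u ** v) = e u ** v + u ** e v) ->
  forall u v, k *: (d (e (u ** v)) - e (d (u ** v))) =
    (k *: (d (e u) - e (d u))) ** v + u ** (k *: (d (e v) - e (d v))).
Proof.
by move=> dD eD dM eM u v; rewrite eM dM dD eD !dM !eM !amulE; module_ring.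
Qed.

(* The derivations [d = bra a x] and [e = bra a y] satisfy
   [4 [d, e] = - [L_x, L_y]], because [d a = - x / 4] and [d y] commutes
   with [a]. *)
Lemma derpair_hh a x y : peirce a -> a ** x = h *: x -> a ** y = h *: y ->
  derpair a x -> derpair a y -> derpair x y.
Proof.
move=> pa ax ay dx dy.
have da : bra a x a = - (h * h) *: x.
  by rewrite /bra (peirce_idem pa) [x ** a]amulC ax !amulE ax; module_field.
have dxy u : bra a (bra a x y) u = 0.
  apply: bra_even => //; rewrite /bra ay !amulE.
  by rewrite (peircehh pa ax ay) (peircehh pa ax ay).
have comm u : bra x y u =
    - 4%:R *: (bra a x (bra a y u) - bra a y (bra a x u)).
  (* Leibniz rule for [d = bra a x]: [[d, [L_a, L_y]] = [L_{d a}, L_y] + [L_a, L_{d y}]]. *)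
  have -> : bra a x (bra a y u) =
      bra (bra a x a) y u + bra a (bra a x y) u + bra a y (bra a x u).
    rewrite {2}/bra [bra a x (_ - _)](_ : _ = bra a x (a ** (y ** u)) -
      bra a x (y ** (a ** u))); last by rewrite /bra !amulE; module_ring.
    rewrite !dx /bra !amulE; module_ring.
  by rewrite dxy da braZl; module_field.
have braA p q u v : bra p q (u + v) = bra p q u + bra p q v.
  by rewrite /bra !amulE; module_ring.
move=> u v; rewrite !comm.
by apply: commutator_der; [exact: braA | exact: braA | exact: dx | exact: dy].
Qed.

(** Along the eigenspaces of [a], the two sides reduce to half the obstructions of [(xh, y0)] and
    [(yh, x0)], which agree because [[L_b, L_c]] is a derivation. *)
Lemma derdef_swap a b c z w : prim a -> derpair a b -> derpair a c ->
  derpair b c -> derdef (a ** b) c z w = derdef (a ** c) b z w.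
Proof.
move=> qa; have [_ pa _] := qa.
have [k [x0 [xh [ax0 axh ->]]]] := prim_dec b qa.
have [l [y0 [yh [ay0 ayh ->]]]] := prim_dec c qa.
move=> /(derpair_half qa ax0) dx /(derpair_half qa ay0) dy dbc.
have dhh := derpair_hh pa axh ayh dx dy.
have d0 u s t : a ** u = 0 -> derdef a u s t = 0.
  by move=> au; rewrite /derdef !(bra_even _ pa (e := u)) ?au ?amul0r // amulE !subrr.
have daa s t : derdef a a s t = 0 by rewrite /derdef !braxx !amulE !subrr.
have expand s t : derdef x0 y0 s t + derdef x0 yh s t + derdef xh y0 s t = 0.
  have := derdef0 s t dbc; rewrite !(derdefDl, derdefDr, derdefZl, derdefZr).
  rewrite [derdef x0 a s t]derdefC [derdef xh a s t]derdefC daa (d0 x0) ?(d0 y0) //.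
  rewrite (derdef0 _ _ dx) (derdef0 _ _ dy) (derdef0 _ _ dhh).
  by rewrite !(oppr0, scaler0, add0r, addr0) addrA.
have tx0 : tau a x0 = x0 by rewrite tau_even // ax0 amul0r.
have ty0 : tau a y0 = y0 by rewrite tau_even // ay0 amul0r.
(* [tau a] fixes [x0], [y0] and negates [xh], [yh]; comparing [expand] with its conjugate isolates
   the odd terms. *)
have key : derdef x0 yh z w + derdef xh y0 z w = 0.
  have := expand (tau a z) (tau a w).
  have derdefNl p q s t : derdef (- p) q s t = - derdef p q s t.
    by rewrite -scaleN1r derdefZl scaleN1r.
  have derdefNr p q s t : derdef p (- q) s t = - derdef p q s t.
    by rewrite -scaleN1r derdefZr scaleN1r.
  move/(congr1 (tau a)); rewrite 2!tauD !(tau_derdef _ _ _ _ pa).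
  rewrite !(tauK two_neq0 pa) tx0 ty0 (tau_odd two_neq0 axh) (tau_odd two_neq0 ayh).
  rewrite derdefNl derdefNr [tau a 0]tau_even ?amul0r // => e1.
  have e2 := expand z w.
  transitivity (h *: ((derdef x0 y0 z w + derdef x0 yh z w + derdef xh y0 z w) -
    (derdef x0 y0 z w + - derdef x0 yh z w + - derdef xh y0 z w))).
    by module_field.
  by rewrite e1 e2 subr0 scaler0.
rewrite !amulE (peirce_idem pa) ax0 axh ay0 ayh !addr0.
rewrite !(derdefDl, derdefDr, derdefZl, derdefZr) daa (d0 x0) ?(d0 y0) //.
rewrite [derdef xh a _ _]derdefC [derdef yh a _ _]derdefC.
rewrite [derdef yh xh _ _]derdefC.
rewrite (derdef0 _ _ dx) (derdef0 _ _ dy) (derdef0 _ _ dhh).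
have -> : derdef xh y0 z w = derdef yh x0 z w.
  by rewrite [RHS]derdefC; apply/eqP; rewrite -addr_eq0 addrC key.
by rewrite !(oppr0, scaler0, add0r, addr0).
Qed.

(** Two uses of [derdef_swap] identify the three cyclic terms, whose sum is zero by
    [D(a, b, c) = 0]. *)
Lemma derpair_mul a b c : (3%:R : F) != 0 -> prim a -> prim b ->
  derpair a b -> derpair a c -> derpair b c -> derpair (a ** b) c.
Proof.
move=> three qa qb dab dac dbc z w; apply/eqP; rewrite -subr_eq0 opprD addrA.
apply/eqP; rewrite -/(derdef _ _ z w).
have jd u := jdef_axis u qa dab dac.
have sum0 : derdef (a ** b) c z w + derdef (b ** c) a z w +
    derdef (c ** a) b z w = 0.
  transitivity (jdef a b c (z ** w) - jdef a b c z ** w - z ** jdef a b c w).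
    by rewrite /derdef /jdef !amulE; module_ring.
  by rewrite !jd !amulE !subrr.
move: sum0; rewrite [c ** a]amulC (derdef_swap z w qa dac dab (derpairC dbc)).
rewrite -(derdef_swap z w qb (derpairC dab) dbc dac) [b ** a]amulC => sum0.
transitivity (3%:R^-1 *: (derdef (a ** b) c z w + derdef (a ** b) c z w +
    derdef (a ** b) c z w)); first by module_field.
by rewrite sum0 scaler0.
Qed.

End PrimitiveAxes.

(** * Miyamoto closure, spanning sets of axes, two-generated subalgebras *)

Section Spanning.
Variables (F : fieldType) (A : comAlg F).
Hypothesis two_neq0 : (2%:R : F) != 0.
Implicit Types (a b c x y z w : A).
Local Notation h := (2%:R^-1 : F).

Lemma tau_prim a b : peirce a -> prim b -> prim (tau a b).
Proof.
move=> pa [b0 pb b1].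
pose t := tau a.
have tK : involutive t by apply: tauK.
have tM x y : t (x ** y) = t x ** t y by apply: tau_mul.
have tD x y : t (x + y) = t x + t y by apply: tauD.
have t0 : t 0 = 0 by apply: tau_even; rewrite !amul0r.
have tZ k x : t (k *: x) = k *: t x by rewrite -[k *: x]addr0 /t tau_lin -/t t0 addr0.
have tE x u : (t b ** x = u) <-> (b ** t x = t u).
  split=> [<-|e]; first by rewrite tM tK.
  by rewrite -[u]tK -e tM tK.
have tEh x : (t b ** x = h *: x) <-> (b ** t x = h *: t x) by rewrite tE tZ.
have tE0 x : (t b ** x = 0) <-> (b ** t x = 0) by rewrite tE t0.
split.
- by move=> tb; apply: b0; rewrite -[b]tK /t tb -/t t0.
- split.
  + by rewrite -tM (peirce_idem pb).
  + move=> x; have [x1 [x0 [xh [e1 e0 eh ex]]]] := peirce_dec pb (t x).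
    exists (t x1), (t x0), (t xh); split.
    * by apply/tE; rewrite tK.
    * by apply/tE0; rewrite tK.
    * by apply/tEh; rewrite tK.
    * by rewrite -!tD -ex tK.
  + by move=> x y /tE ex /tE ey; apply/tE; rewrite tM; apply: peirce11 pb _ _ _ _.
  + by move=> x y /tE0 ex /tE0 ey; apply/tE0; rewrite tM; apply: peirce00 pb _ _ _ _.
  + move=> x y /tE ex /tE0 ey; rewrite -[LHS]tK tM -[RHS]t0; congr (t _).
    exact: peirce10 pb _ _ _ _.
  + by move=> x y /tE ex /tEh ey; apply/tEh; rewrite tM; apply: peirce1h pb _ _ _ _.
  + by move=> x y /tE0 ex /tEh ey; apply/tEh; rewrite tM; apply: peirce0h pb _ _ _ _.
  + move=> x y /tEh ex /tEh ey; apply/tE; rewrite !tM !tK.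
    exact: peircehh pb _ _ _ _.
- move=> x /tE /b1[k ek]; exists k.
  by rewrite -[x]tK ek tZ.
Qed.

Lemma tau_derpair a x y : peirce a -> derpair x y -> derpair (tau a x) (tau a y).
Proof.
move=> pa d z w; have t2 := tauK two_neq0 pa.
have tb u : bra (tau a x) (tau a y) u = tau a (bra x y (tau a u)).
  by rewrite (tau_bra two_neq0 _ _ _ pa) t2.
by rewrite !tb !(tau_mul two_neq0 pa) d tauD !(tau_mul two_neq0 pa) !t2.
Qed.

(** [b - tau a b] is twice the [A_{1/2}(a)]-component of [b]. Thus axes closed under their Miyamoto
    involutions span a subalgebra. *)
Lemma prim_mul_tau a b : prim a -> exists k,
  a ** b = k *: a + (h * h) *: (b - tau a b).
Proof.
move=> qa; have [k [x0 [xh [a0 ah ->]]]] := prim_dec b qa.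
have [_ pa _] := qa; exists k.
rewrite !tauD [tau a (k *: a)]tau_even; last first.
  by rewrite !amulE !(peirce_idem pa).
rewrite [tau a x0]tau_even ?a0 ?amul0r // (tau_odd two_neq0 ah).
by rewrite !amulE (peirce_idem pa) a0 ah; module_field.
Qed.

Lemma linear_span0 (S : set A) : linear_span S 0.
Proof. by move=> U U0. Qed.

Lemma linear_span_lin (S : set A) (k : F) x y :
  linear_span S x -> linear_span S y -> linear_span S (k *: x + y).
Proof. by move=> Sx Sy U U0 Ul SU; apply: (Ul); [apply: (Sx U) | apply: (Sy U)]. Qed.

Lemma linear_span_sub (S : set A) : S `<=` linear_span S.
Proof. by move=> x Sx U _ _; apply. Qed.

Lemma linear_span_ind (S U : set A) : U 0 ->
  (forall (k : F) u v, U u -> U v -> U (k *: u + v)) -> S `<=` U ->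
  linear_span S `<=` U.
Proof. by move=> U0 Ul SU x; apply. Qed.

Lemma linear_span_subalgebra (S : set A) :
  (forall a b, S a -> S b -> linear_span S (a ** b)) ->
  subalgebra (linear_span S).
Proof.
move=> SM; split; [exact: linear_span0|exact: linear_span_lin|].
move=> u v Su Sv; move: u Su; apply: linear_span_ind.
- by rewrite amul0l; apply: linear_span0.
- by move=> k u u' Su Su'; rewrite /= amulDl amulZl; apply: linear_span_lin.
move=> a Sa; move: v Sv; apply: linear_span_ind.
- by rewrite amul0r; apply: linear_span0.
- by move=> k u u' Su Su'; rewrite /= amulDr amulZr; apply: linear_span_lin.
- by move=> b Sb; apply: SM.
Qed.

Lemma tau_closed_span (S : set A) : (forall a, S a -> prim a) ->
  (forall a b, S a -> S b -> S (tau a b)) ->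
  generated_subalgebra S = [set: A] -> linear_span S = [set: A].
Proof.
move=> Sprim Stau Sgen; apply/seteqP; split=> // x _.
have : generated_subalgebra S x by rewrite Sgen.
apply; last exact: linear_span_sub.
apply: linear_span_subalgebra => a b Sa Sb.
have [k ->] := prim_mul_tau b (Sprim a Sa).
apply: linear_span_lin; first exact: linear_span_sub.
rewrite -[_ *: _]addr0; apply: linear_span_lin; last exact: linear_span0.
rewrite addrC -scaleN1r; apply: linear_span_lin; apply: linear_span_sub => //.
exact: Stau.
Qed.

(* A maximal set of pairwise derivation-related axes is closed under the
   Miyamoto involutions of its members, hence spans [A]. *)
Lemma jordan_of_generators (X : set A) : (3%:R : F) != 0 ->
  (forall a, X a -> prim a) -> (forall a b, X a -> X b -> derpair a b) ->
  generated_subalgebra X = [set: A] -> jordan A.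
Proof.
move=> three Xprim Xder Xgen.
pose P (Y : set A) := (forall a, Y a -> prim a) /\
  (forall a b, Y a -> Y b -> derpair a b).
(* Zorn's lemma runs over the part [Y] adjoined to [X], so that the empty chain stands for [X]
   itself. *)
have [Y [PY Ymax]] : exists Y, P (X `|` Y) /\ forall W, Y `<` W -> ~ P (X `|` W).
  apply: (@Zorn_bigcup _ (fun Y => P (X `|` Y))) => C CP Ctot; split.
    by move=> a [/Xprim //|[Y /CP[Yprim _] Ya]]; apply: Yprim; right.
  move=> a b [Xa|[Y1 C1 Y1a]] [Xb|[Y2 C2 Y2b]].
  - exact: Xder.
  - by apply: (CP _ C2).2; [left | right].
  - by apply: (CP _ C1).2; [right | left].
  - have [le12|le21] := Ctot _ _ C1 C2.
      by apply: (CP _ C2).2; right => //; apply: le12.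
    by apply: (CP _ C1).2; right => //; apply: le21.
set Z := X `|` Y in PY; have [Zprim Zder] := PY.
have Zpeirce a : Z a -> peirce a by move=> /Zprim[].
apply: (jordan_of_span two_neq0 Zprim Zder); apply: tau_closed_span => //; last first.
  apply/seteqP; split=> // x _; have : generated_subalgebra X x by rewrite Xgen.
  by move=> + U sU ZU; apply=> // y Xy; apply: ZU; left.
move=> a b Za Zb; apply: contrapT => Ztab.
apply: (Ymax (Y `|` tau a @` Z)).
  split=> [y Yy|YZ]; first by left.
  by apply: Ztab; right; apply: YZ; right; exists b.
have dertau c d : Z c -> Z d -> derpair c (tau a d).
  move=> Zc Zd; apply: derpairC.
  have -> : tau a d = d - 8%:R *: (a ** d) + 8%:R *: (a ** (a ** d)) by [].
  have [k [x0 [xh [a0 ah ed]]]] := prim_dec d (Zprim a Za).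
  (* Primitivity gives [a (a d) = (a d + k a) / 2], so [tau a d] is a combination of [a], [a d] and
     [d]; [derpair_mul] handles [a d]. *)
  have -> : d - 8%:R *: (a ** d) + 8%:R *: (a ** (a ** d)) =
      (4%:R * k) *: a + (- 4%:R *: (a ** d) + d).
    rewrite ed !amulE (peirce_idem (Zpeirce a Za)) a0 ah !amulE.
    by rewrite (peirce_idem (Zpeirce a Za)) ah; module_field.
  apply: derpairC; apply: derpair_lin; first exact: Zder.
  apply: derpair_lin; last exact: Zder.
  apply: derpairC; apply: derpair_mul => //; try exact: Zprim.
  - exact: Zder.
  - exact: Zder.
  - exact: Zder.
rewrite setUA; split.
  move=> _ [/Zprim //|[c Zc <-]].
  by apply: tau_prim; [exact: Zpeirce | exact: Zprim].
move=> c d [Zc|[c' Zc <-]] [Zd|[d' Zd <-]].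
- exact: Zder.
- exact: dertau.
- by apply: derpairC; apply: dertau.
- by apply: tau_derpair; [exact: Zpeirce | exact: Zder].
Qed.

(* Multiplication table of a 2-generated subalgebra; [k] is the value of the
   Frobenius form at [(a, b)]. *)
Lemma prim_pair a b : prim a -> prim b -> exists (k : F) w b0,
  [/\ a ** w = h *: w, a ** b0 = 0 & b = k *: a + w + b0] /\
  [/\ w ** w = (k * (1 - k)) *: a + k *: b0,
      w ** b0 = (h * (1 - k)) *: w & b0 ** b0 = (1 - k) *: b0].
Proof.
move=> qa qb; have [_ pa a1] := qa; have [_ pb _] := qb.
have [k [b0 [w [ab0 aw eb]]]] := prim_dec b qa.
have [l [a0 [v [ba0 bv ea]]]] := prim_dec a qb.
have [w1 [w0 [/a1[q ->] aw0 eww]]] := even_split (peircehh pa aw aw).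
have aw00 := peirce00 pa ab0 ab0.
have awb0 : a ** (w ** b0) = h *: (w ** b0).
  by rewrite amulC -[w ** b0]amulC [_ ** a]amulC (peirce0h pa ab0 aw).
(* Components of [b b = b] in [A_1(a)], [A_0(a)] and [A_{1/2}(a)]. *)
have [/eqP q_eq w0_eq wb0_eq] : [/\ k * k + q - k = 0, w0 + b0 ** b0 - b0 = 0 &
    k *: w + 2%:R *: (w ** b0) - w = 0].
  apply: (prim_uniq two_neq0 qa); first by rewrite !amulE aw0 aw00 ab0; module_ring.
    by rewrite !amulE awb0 aw; module_ring.
  transitivity (b ** b - b); last by rewrite (peirce_idem pb) subrr.
  rewrite [in RHS]eb !amulE [w ** a]amulC [b0 ** a]amulC [b0 ** w]amulC.
  by rewrite (peirce_idem pa) aw ab0 eww; module_field.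
(* [s := ab - (a + b) / 2] is an eigenvector of both [a] and [b] *)
have b0_eq : b0 = (k - 1) *: a - 2%:R *: (a ** b - h *: a - h *: b).
  by rewrite eb !amulE (peirce_idem pa) aw ab0; module_field.
have bs : b ** (a ** b - h *: a - h *: b) = (h * (l - 1)) *: b.
  rewrite [a ** b]amulC {1 2}ea !amulE (peirce_idem pb) bv ba0 !amulE.
  by rewrite (peirce_idem pb) bv; module_field.
have bb0 : b ** b0 = (k - 1) *: (a ** b) - (l - 1) *: b.
  by rewrite b0_eq amulDr amulNr !amulZr bs [b ** a]amulC; module_field.
have wb0 : w ** b0 = (h * (1 - k)) *: w.
  transitivity (h *: ((k *: w + 2%:R *: (w ** b0) - w) + (1 - k) *: w)).
    by module_field.
  by rewrite wb0_eq add0r scalerA.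
(* Compares [bb0] with the product computed from the decomposition of [b], componentwise along
   [a]. *)
have [k_eq b00_eq w_eq] : [/\ k * (k - l) = 0, (1 - l) *: b0 - b0 ** b0 = 0 &
    (k - l) *: w = 0].
  apply: (prim_uniq two_neq0 qa); first by rewrite !amulE aw00 ab0; module_ring.
    by rewrite !amulE aw; module_ring.
  transitivity ((k - 1) *: (a ** b) - (l - 1) *: b - b ** b0).
    rewrite [in RHS]eb !amulE (peirce_idem pa) aw ab0 wb0.
    by module_field.
  by rewrite bb0 subrr.
(* Symmetry of the form: otherwise [k = 0] and [w = 0], so [a b = 0], which forces [l = 0] as
   well. *)
have kl : k = l.
  apply/eqP; rewrite -subr_eq0; apply/negPn/negP => kl.
  have k0 : k = 0 by apply/eqP; move/eqP: k_eq; rewrite mulf_eq0 (negbTE kl) orbF.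
  have w_0 : w = 0 by apply/eqP; move/eqP: w_eq; rewrite scaler_eq0 (negbTE kl).
  have ab : a ** b = 0.
    by rewrite eb k0 w_0 !amulE ab0; module_ring.
  have [l0 _ _] : [/\ l = 0, (0 : A) = 0 & h *: v = 0].
    apply: (prim_uniq two_neq0 qb); [by rewrite amul0r|by rewrite amulE bv|].
    transitivity (b ** a); last by rewrite amulC.
    by rewrite [in RHS]ea !amulE (peirce_idem pb) ba0 bv; module_ring.
  by move: kl; rewrite l0 k0 subrr eqxx.
have b00 : b0 ** b0 = (1 - k) *: b0.
  by move/eqP: b00_eq; rewrite subr_eq0 -kl => /eqP.
exists k, w, b0; split; first by split=> //; rewrite eb addrAC.
split=> //; rewrite eww.
have -> : q = k * (1 - k).
  by apply/eqP; rewrite -subr_eq0 -(eqP q_eq) //; apply/eqP; ring.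
congr (_ + _); transitivity (w0 + b0 ** b0 - b0 + (b0 - b0 ** b0)).
  by module_ring.
by rewrite w0_eq b00; module_ring.
Qed.

End Spanning.

(** * Vector-valued polynomial maps and their first-order jets at 0 *)

Section Jets.
Variables (K : fieldType) (V : comAlg K).

Definition peval (r : seq V) (s : K) := foldr (fun v u => v + s *: u) 0 r.

Definition polyf (f : K -> V) := exists r, f =1 peval r.

Lemma polyf_ext f g : f =1 g -> polyf g -> polyf f.
Proof. by move=> fg [r gr]; exists r => s; rewrite fg. Qed.

Lemma polyf_const v : polyf (fun=> v).
Proof. by exists [:: v] => s; rewrite /= scaler0 addr0. Qed.

Lemma polyf_mulX f : polyf f -> polyf (fun s => s *: f s).
Proof. by move=> [r fr]; exists (0 :: r) => s; rewrite /= add0r fr. Qed.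

Lemma polyfD f g : polyf f -> polyf g -> polyf (fun s => f s + g s).
Proof.
move=> [r fr] [t gt]; suff [u ut] : polyf (fun s => peval r s + peval t s).
  by exists u => s; rewrite fr gt ut.
elim: r t {fr gt} => [|x r IHr] [|y t].
- by exists [::] => s; rewrite /= addr0.
- by exists (y :: t) => s; rewrite /= add0r.
- by exists (x :: r) => s; rewrite /= addr0.
- have [u ut] := IHr t; exists (x + y :: u) => s.
  by rewrite /= addrACA -scalerDr ut.
Qed.

Lemma polyf_amul f g : polyf f -> polyf g -> polyf (fun s => f s ** g s).
Proof.
move=> [r fr] [t gt]; apply: (@polyf_ext _ (fun s => peval r s ** peval t s)).
  by move=> s; rewrite fr gt.
have mul_const v : polyf (fun s => v ** peval t s).
  elim: t {gt} => [|y t IHt].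
    by apply: polyf_ext (polyf_const 0) => s; rewrite /= amul0r.
  apply: polyf_ext (polyfD (polyf_const (v ** y)) (polyf_mulX IHt)) => s.
  by rewrite /= amulDr amulZr.
elim: r {fr} => [|x r IHr].
  by apply: polyf_ext (polyf_const 0) => s; rewrite /= amul0l.
apply: polyf_ext (polyfD (mul_const x) (polyf_mulX IHr)) => s.
by rewrite /= amulDl amulZl.
Qed.

Lemma polyfZ k f : polyf f -> polyf (fun s => k *: f s).
Proof.
move=> [r fr]; exists [seq k *: v | v <- r] => s; rewrite fr {fr}.
elim: r => [|x r IHr] /=; first by rewrite scaler0.
by rewrite -IHr scalerDr !scalerA mulrC.
Qed.

(** Value and derivative at [0]; the polynomial remainder makes this algebraic, in any
    characteristic. *)
Definition jet (f : K -> V) u v :=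
  exists2 g, polyf g & forall s, f s = u + s *: v + (s * s) *: g s.

Lemma jet_eq f u v u' v' : jet f u v -> u = u' -> v = v' -> jet f u' v'.
Proof. by move=> fj <- <-. Qed.

Lemma jet_polyf f u v : jet f u v -> polyf f.
Proof.
move=> [g gp fg]; apply: polyf_ext
  (polyfD (polyfD (polyf_const u) (polyf_mulX (polyf_const v)))
          (polyf_mulX (polyf_mulX gp))) => s.
by rewrite fg scalerA.
Qed.

Lemma jet_affine u v w : jet (fun s => u + s *: v + (s * s) *: w) u v.
Proof. by exists (fun=> w) => //; apply: polyf_const. Qed.

Lemma jet_const u : jet (fun=> u) u 0.
Proof.
by exists (fun=> 0) => [|s]; [apply: polyf_const | rewrite !scaler0 !addr0].
Qed.

Lemma jetD f g u v u' v' : jet f u v -> jet g u' v' ->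
  jet (fun s => f s + g s) (u + u') (v + v').
Proof.
move=> [p pp fp] [q qp gq]; exists (fun s => p s + q s); first exact: polyfD.
by move=> s; rewrite fp gq; module_ring.
Qed.

Lemma jetZ k f u v : jet f u v -> jet (fun s => k *: f s) (k *: u) (k *: v).
Proof.
move=> [p pp fp]; exists (fun s => k *: p s); first exact: polyfZ.
by move=> s; rewrite fp; module_ring.
Qed.

(** The factor is [1] modulo [s^2], so clearing denominators on the conic preserves jets. *)
Lemma jet_conic q f u v : jet f u v -> jet (fun s => (1 + s * s * q) *: f s) u v.
Proof.
move=> fj; have fp := jet_polyf fj; have [p pp fE] := fj.
exists (fun s => p s + q *: f s); first exact: (polyfD pp (polyfZ q fp)).
by move=> s; rewrite {1}fE [f s]fE; module_ring.
Qed.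

Lemma jet_amul f g u v u' v' : jet f u v -> jet g u' v' ->
  jet (fun s => f s ** g s) (u ** u') (u ** v' + v ** u').
Proof.
move=> [p pp fp] [q qp gq].
exists (fun s => (v ** v' + (u ** q s + p s ** u')) +
  (s *: (v ** q s + p s ** v') + s *: (s *: (p s ** q s)))).
  have c x := polyf_const x.
  apply: polyfD.
    apply: polyfD; first exact: c.
    by apply: polyfD; apply: polyf_amul.
  apply: polyfD; apply: polyf_mulX.
    by apply: polyfD; apply: polyf_amul.
  by apply: polyf_mulX; apply: polyf_amul.
by move=> s; rewrite fp gq !amulE; module_ring.
Qed.

Lemma polyf_form f (l : V -> K) : {morph l : u v / u + v >-> u + v} ->
  (forall k u, l (k *: u) = k * l u) -> l 0 = 0 -> polyf f ->
  exists p : {poly K}, forall s, l (f s) = p.[s].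
Proof.
move=> lD lZ l0 [r fr].
suff [p pr] : exists p : {poly K}, forall s, l (peval r s) = p.[s].
  by exists p => s; rewrite fr.
elim: r {fr} => [|v r [p pr]] /=; first by exists 0 => s; rewrite horner0.
exists ((l v)%:P + p * 'X) => s.
by rewrite lD lZ pr !hornerE mulrC.
Qed.

(** A linear form turns [f] into a polynomial [P]. With [Q = 1 + q X^2], [P Q] vanishes at every
    point of an algebraically closed field, hence is zero, and so is [P]. *)
Lemma jet_vanish q f u v : GRing.closed_field_axiom K -> jet f u v ->
  (forall s, 1 + s * s * q != 0 -> f s = 0) -> v = 0.
Proof.
move=> closedK [g gp fg] f0; apply: lin_form_eq => l lD lZ lN l0; rewrite l0.
have [p pg] := polyf_form lD lZ l0 gp.
pose P : {poly K} := (l u)%:P + ((l v)%:P + p * 'X) * 'X.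
pose Q : {poly K} := 1%:P + q%:P * ('X * 'X).
have PQ : P * Q = 0.
  apply/eqP/negPn/negP => /(PreClosedField.closed_nonrootP closedK)[s].
  rewrite /root hornerM mulf_eq0 negb_or => /andP[/negP Ps Qs]; apply: Ps.
  have -> : P.[s] = l (f s).
    by rewrite fg !lD !lZ pg !hornerE; ring.
  rewrite f0 ?l0 //; suff -> : 1 + s * s * q = Q.[s] by [].
  by rewrite hornerD !hornerM !hornerX !hornerC; ring.
have Q0 : Q != 0.
  apply/eqP => /(congr1 (fun p : {poly K} => p.[0])) /eqP.
  by rewrite hornerD !hornerM !hornerX !hornerC !mulr0 addr0 oner_eq0.
have P0 : P = 0 by apply/eqP; move/eqP: PQ; rewrite mulf_eq0 (negbTE Q0) orbF.
have := congr1 (fun p : {poly K} => p`_1) P0.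
by rewrite /P !(coefD, coefMX, coefC, coef0) /= addr0 add0r.
Qed.

End Jets.

(** * The conic of idempotents through an axis *)

Section Conic.
Variables (K : fieldType) (V : comAlg K).
Hypothesis two_neq0 : (2%:R : K) != 0.
Local Notation h := (2%:R^-1 : K).
Variables (a w b : V) (k : K).
Hypotheses (aa : a ** a = a) (aw : a ** w = h *: w) (ab : a ** b = 0)
  (ww : w ** w = (k * (1 - k)) *: a + k *: b)
  (wb : w ** b = (h * (1 - k)) *: w) (bb : b ** b = (1 - k) *: b).

(* The elements [conic s / conic_norm s] are primitive idempotents of the span
   of [a, w, b], equal to [a] at [s = 0], with tangent vector [w]. *)
Definition conic s : V := a + s *: w + (s * s) *: (k *: b).
Definition conic_norm s : K := 1 + s * s * (k * (1 - k)).

Let wa : w ** a = h *: w. Proof. by rewrite amulC. Qed.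
Let ba : b ** a = 0. Proof. by rewrite amulC. Qed.
Let bw : b ** w = (h * (1 - k)) *: w. Proof. by rewrite amulC. Qed.
Let tableE := (aa, aw, ab, wa, ww, wb, ba, bw, bb).

Lemma conic_idem s : conic s ** conic s = conic_norm s *: conic s.
Proof. by rewrite /conic /conic_norm !(amulE, tableE); module_field. Qed.

(** Eigenvectors of [conic s / conic_norm s] for [1/2] and, in [conic_zero], for [0]; they deform
    [w] and [b]. *)
Definition conic_half s : V := (1 - s * s * (k * (1 - k))) *: w -
  (2%:R * s) *: ((k * (1 - k)) *: a - k *: b).
Definition conic_zero s : V :=
  b - ((1 - k) * s) *: w + ((1 - k) ^+ 2 * k * (s * s)) *: a.

Lemma conic_mul_half s :
  conic s ** conic_half s = (h * conic_norm s) *: conic_half s.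
Proof.
by rewrite /conic /conic_norm /conic_half !(amulE, tableE); module_field.
Qed.

Lemma conic_mul_zero s : conic s ** conic_zero s = 0.
Proof. by rewrite /conic /conic_zero !(amulE, tableE); module_field. Qed.

(** Cramer's rule: the transition determinant is [conic_norm s ^+ 3], and one factor cancels against
    the adjugate. *)
Lemma conic_basis s x y z : exists p r t,
  conic_norm s ^+ 2 *: (x *: a + y *: w + z *: b) =
  p *: conic s + r *: conic_half s + t *: conic_zero s.
Proof.
pose m := 1 - k; pose q := k * m.
exists (x + y * (2%:R * q * s) + z * (m ^+ 2 * k * (s * s))).
exists (- x * s + y * (1 - s * s * q) + z * (m * s)).
exists (x * (s * s * k) - y * (2%:R * s * k) + z).
rewrite /conic_norm /conic /conic_half /conic_zero /q /m; module_ring.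
Qed.

(** Primitivity. The proof shows [r *: d = 0] and [t *: e = 0] rather than [r = t = 0], since [w] or
    [b] may be zero. *)
Lemma conic_eig1 s x y z : conic_norm s != 0 ->
  let u := x *: a + y *: w + z *: b in
  conic s ** u = conic_norm s *: u -> exists p, u = p *: conic s.
Proof.
move=> n0 u; have [p [r [t]]] := conic_basis s x y z; rewrite -/u.
have := conic_mul_zero s; have := conic_mul_half s; have := conic_idem s.
move: (conic s) (conic_half s) (conic_zero s) (conic_norm s) n0 {x y z} u.
move=> c d e n n0 u cc cd ce ue cu.
have eq1 : (p * n) *: c + (r * (h * n)) *: d = n *: (p *: c + r *: d + t *: e).
  rewrite -ue; transitivity (c ** (n ^+ 2 *: u)).
    by rewrite ue !amulE cc cd ce; module_ring.
  by rewrite amulZr cu !scalerA mulrC.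
have eq2 : (h * r) *: d + t *: e = 0.
  apply: (scalerI n0).
  transitivity (n *: (p *: c + r *: d + t *: e) -
    ((p * n) *: c + (r * (h * n)) *: d)); first by module_field.
  by rewrite -eq1 subrr scaler0.
have rd : r *: d = 0.
  apply: (scalerI n0); transitivity (4%:R *: (c ** ((h * r) *: d + t *: e))).
    by rewrite !amulE cd ce; module_field.
  by rewrite eq2 amul0r !scaler0.
have te : t *: e = 0.
  by move: eq2; rewrite -scalerA rd scaler0 add0r.
have n20 : n ^+ 2 != 0 by rewrite expf_neq0.
exists (n ^- 2 * p); apply: (scalerI n20).
by rewrite ue rd te !addr0 scalerA mulrA divff ?mul1r.
Qed.

Lemma conic_neq0 s : a <> 0 -> conic s <> 0.
Proof.
(* [2 L_a^2 - L_a] fixes [a] and kills [w] and [b]. *)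
move=> a0 c0; apply: a0; transitivity (2%:R *: (a ** (a ** conic s)) - a ** conic s).
  by rewrite /conic !(amulE, tableE); module_field.
by rewrite c0 !amul0r scaler0 subrr.
Qed.

(** Derivative of [tau a x] in [a], in the direction [w]. *)
Definition tau_dot x := - 8%:R *: (w ** x) + 8%:R *: (a ** (w ** x) + w ** (a ** x)).

(* First-order coefficient at [s = 0] of the statement that the Miyamoto
   involutions of the conic are automorphisms. *)
Lemma tau_dot_mul x y : GRing.closed_field_axiom K ->
  (forall s, conic_norm s != 0 -> peirce ((conic_norm s)^-1 *: conic s)) ->
  tau_dot (x ** y) = tau_dot x ** tau a y + tau a x ** tau_dot y.
Proof.
move=> closedK conic_axis.
pose n s := conic_norm s.
(* [tau] at [conic s / conic_norm s], multiplied by [conic_norm s ^+ 2] to be polynomial in [s]. *)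
pose T z s := n s *: (n s *: z) + (- 8%:R *: (n s *: (conic s ** z)) +
  8%:R *: (conic s ** (conic s ** z))).
have jc : jet conic a w by apply: jet_affine.
have jn (f : K -> V) u v : jet f u v -> jet (fun s => n s *: f s) u v.
  exact: jet_conic.
have jT z : jet (T z) (tau a z) (tau_dot z).
  have jz := jet_amul jc (jet_const z).
  have jTz := jetD (jn _ _ _ (jn _ _ _ (jet_const z)))
    (jetD (jetZ (- 8%:R) (jn _ _ _ jz)) (jetZ 8%:R (jet_amul jc jz))).
  by apply: jet_eq jTz _ _; rewrite /tau /tau_dot ?amulE; module_ring.
have := jetD (jn _ _ _ (jn _ _ _ (jT (x ** y))))
  (jetZ (-1) (jet_amul (jT x) (jT y))).
move/(jet_vanish (q := k * (1 - k)) closedK) => van.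
apply/eqP; rewrite -subr_eq0 addrC -scaleN1r [_ + tau a x ** _]addrC.
apply/eqP; rewrite addrC; apply: van => s; rewrite -/(conic_norm s) => n0.
have TE z : T z s = n s ^+ 2 *: tau ((n s)^-1 *: conic s) z.
  rewrite /tau /T; move: n0; rewrite -/(n s); move: (n s) (conic s) => m c m0.
  rewrite !amulE; lin_form_intro; field; exact: m0.
by rewrite !TE (tau_mul two_neq0 (conic_axis s n0)) amulZl amulZr; module_ring.
Qed.

(* With [tau_dot_mul], this makes [[L_a, L_w]] a derivation. *)
Lemma tau_dot_tau x : peirce a -> tau_dot (tau a x) = - 8%:R *: bra a w x.
Proof.
move=> pa; have [e [o [ae ao ->]]] := peirce_grading pa x.
rewrite tauD (tau_even ae) (tau_odd two_neq0 ao) /tau_dot /bra !amulE ao !amulE.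
rewrite [w ** e]amulC (even_odd pa ae aw); module_field.
Qed.

End Conic.

(** * Peirce theory of idempotents when [D = 0] *)

Section JordanPeirce.
Variables (F : fieldType) (A : comAlg F).
Hypothesis two_neq0 : (2%:R : F) != 0.
Local Notation h := (2%:R^-1 : F).

(** Polarization in two stages, dividing only by 2: the second difference of the cubic is
    [2 D(x, y, y)]. *)
Lemma jordan_jdef : jordan A -> forall x y z w : A, jdef x y z w = 0.
Proof.
move=> jA.
have cubic (x y : A) : bra (x ** x) x y = 0.
  by rewrite /bra [x ** y]amulC -jA [_ ** x]amulC subrr.
have quad (x y w : A) : jdef x y y w = 0.
  transitivity (h *: (bra ((x + y) ** (x + y)) (x + y) w +
    bra ((x - y) ** (x - y)) (x - y) w - 2%:R *: bra (x ** x) x w)).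
    by rewrite /jdef /bra !amulE [y ** x]amulC; module_field.
  by rewrite !cubic scaler0 subr0 addr0 scaler0.
move=> x y z w.
transitivity (h *: (jdef x (y + z) (y + z) w - jdef x y y w - jdef x z z w)).
  by rewrite !(jdefDm, jdefDr) [jdef x z y w]jdefC; module_field.
by rewrite !quad !subr0 scaler0.
Qed.

(** [D(c, c, x) c = 0] says [2 L_c^3 - 3 L_c^2 + L_c = 0], with roots [0], [1/2], [1]. On an
    [i]-eigenvector [x], [D(c, c, x) = (1 - 2 i) [L_c, L_x]], whence the fusion rules for
    [i = 0, 1]. *)
Lemma peirce_idempotent (c : A) : (forall x y z w : A, jdef x y z w = 0) ->
  c ** c = c -> peirce c.
Proof.
move=> J cc.
have cubic x : 2%:R *: (c ** (c ** (c ** x))) = 3%:R *: (c ** (c ** x)) - c ** x.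
  have := J c c x c; rewrite /jdef /bra !cc ![x ** c]amulC ![(c ** x) ** c]amulC.
  move=> e.
  apply/eqP; rewrite -subr_eq0 -oppr_eq0 -[X in _ == X]e; apply/eqP; module_ring.
have eig (i : F) x y : 1 - 2%:R * i != 0 -> c ** x = i *: x ->
    c ** (x ** y) = x ** (c ** y).
  move=> i0 cx; apply: (scalerI i0); have := J c c x y.
  rewrite /jdef /bra cc [x ** c]amulC cx !amulE => e.
  by apply/eqP; rewrite -subr_eq0 -[X in _ == X]e; apply/eqP; module_ring.
have eig1 x y : c ** x = x -> c ** (x ** y) = x ** (c ** y).
  move=> cx; apply: (eig 1); last by rewrite scale1r.
  by rewrite (_ : 1 - _ = -1) ?oppr_eq0 ?oner_eq0 //; ring.
have eig0 x y : c ** x = 0 -> c ** (x ** y) = x ** (c ** y).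
  move=> cx; apply: (eig 0); last by rewrite scale0r.
  by rewrite mulr0 subr0 oner_eq0.
split=> // [x|x y cx cy|x y cx cy|x y cx cy|x y cx cy|x y cx cy|x y cx cy].
- have c3 : c ** (c ** (c ** x)) = (3%:R * h) *: (c ** (c ** x)) - h *: (c ** x).
    transitivity (h *: (2%:R *: (c ** (c ** (c ** x))))); first by module_field.
    by rewrite cubic; module_field.
  (* Lagrange projections for [1], [0], [1/2]: [2 t^2 - t], [1 - 3 t + 2 t^2], [4 t - 4 t^2] at
     [t = L_c]. *)
  exists (2%:R *: (c ** (c ** x)) - c ** x).
  exists (x - 3%:R *: (c ** x) + 2%:R *: (c ** (c ** x))).
  exists (4%:R *: (c ** x) - 4%:R *: (c ** (c ** x))).
  by split; rewrite ?amulE ?c3; module_field.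
- by rewrite (eig1 _ _ cx) cy.
- by rewrite (eig0 _ _ cx) cy amul0r.
- rewrite amulC; have := eig0 _ x cy; rewrite cx [c ** _]amulC.
  have := eig1 _ y cx; rewrite cy amul0r [y ** x]amulC => e.
  by rewrite [_ ** c]amulC e.
- by rewrite (eig1 _ _ cx) cy amulZr.
- by rewrite (eig0 _ _ cx) cy amulZr.
(* In [D(c, x, y) c] the outer terms cancel, leaving [c (x y) - c (c (x y))]. *)
- have := J c x y c; rewrite /jdef /bra cx [y ** c]amulC cy => e.
  apply/eqP; rewrite eq_sym -subr_eq0 -[X in _ == X]e; apply/eqP.
  rewrite !amulE cc [x ** c]amulC [y ** c]amulC [x ** y ** c]amulC cx cy !amulE.
  by rewrite [y ** x]amulC; module_field.
Qed.

End JordanPeirce.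

(** * Extension of scalars and solid pairs *)

Section Solid.
Variables (F E : fieldType) (iota : {rmorphism F -> E}) (A : comAlg F).
Hypothesis two_neq0 : (2%:R : F) != 0.
Local Notation AE := (scalext_alg iota A).
Local Notation T := (@tens F E iota A : A -> AE).

Lemma tens_lin (k : F) (u v : A) : T (k *: u + v) = iota k *: T u + T v.
Proof. exact: tens_semilin. Qed.

Lemma tensD (u v : A) : T (u + v) = T u + T v.
Proof. by rewrite -[u]scale1r tens_lin rmorph1 !scale1r. Qed.

Lemma tens0 : T 0 = 0.
Proof. by apply: (addrI (T 0)); rewrite -tensD !addr0. Qed.

Lemma tensZ (k : F) (u : A) : T (k *: u) = iota k *: T u.
Proof. by rewrite -[k *: u]addr0 tens_lin tens0 addr0. Qed.

Lemma tensN (u : A) : T (- u) = - T u.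
Proof. by rewrite -scaleN1r tensZ rmorphN1 scaleN1r. Qed.

Lemma tensM (u v : A) : T (u ** v) = T u ** T v.
Proof. by rewrite tens_mul. Qed.

Definition tensE := (tensD, tensZ, tensN, tensM, tens0).

(** A linear form followed by [iota] is semilinear, so it factors through the tensor product and
    separates [u] from [v]. *)
Lemma tens_inj : injective T.
Proof.
move=> u v Tuv; apply: lin_form_eq => l lD lZ lN l0.
pose g (x : A) : E^o := iota (l x).
have gl : semilin iota g by move=> k x y; rewrite /g lD lZ rmorphD rmorphM.
have := (scalext_eqP iota [:: (1, u)] [:: (1, v)]).1 Tuv _ _ gl.
rewrite /tens_eval !big_seq1 /= !scale1r; exact: fmorph_inj.
Qed.

Lemma scalext_ind (P : AE -> Prop) : P 0 ->
  (forall (k : E) u v, P u -> P v -> P (k *: u + v)) ->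
  (forall u, P (T u)) -> forall x, P x.
Proof.
move=> P0 Pl PT x; rewrite -[x]reprK scalextE.
elim: (repr x) => [|p s IHs]; first by rewrite big_nil.
by rewrite big_cons; apply: Pl.
Qed.

(** [D = 0] is multilinear, unlike the Jordan identity, so it can be checked on pure tensors one
    argument at a time. *)
Lemma jordan_solid (a b : A) : jordan A -> solid iota a b.
Proof.
move=> jA c [_ c0 cc _].
have two_neq0E : (2%:R : E) != 0 by rewrite -(rmorph_nat iota) fmorph_eq0.
apply/(J_half_axisP two_neq0E); split=> //.
apply: (peirce_idempotent two_neq0E) => //.
move: c {c0 cc} => _ x y z w.
have Tbra u v t : bra (T u) (T v) (T t) = T (bra u v t) by rewrite /bra !tensE.
have jT u v t r : jdef (T u) (T v) (T t) (T r) = 0.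
  by rewrite /jdef -!tensM !Tbra -!tensD -/(jdef u v t r) jordan_jdef // tens0.
have jdef0l (u v t : AE) : jdef 0 u v t = 0.
  by rewrite /jdef /bra !amulE; module_ring.
have jT4 (u v t : A) : jdef (T u) (T v) (T t) w = 0.
  elim/scalext_ind: w => [|k p q pe qe|r]; last exact: jT.
    by rewrite /jdef /bra !amulE; module_ring.
  transitivity (k *: jdef (T u) (T v) (T t) p + jdef (T u) (T v) (T t) q).
    by rewrite /jdef /bra !amulE; module_ring.
  by rewrite pe qe scaler0 addr0.
have jT3 (u v : A) : jdef (T u) (T v) z w = 0.
  elim/scalext_ind: z => [|k p q pe qe|t]; last exact: jT4.
    by rewrite jdef_rot jdef_rot jdef0l.
  by rewrite jdefDr jdefZr pe qe scaler0 addr0.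
have jT2 (u : A) : jdef (T u) y z w = 0.
  elim/scalext_ind: y => [|k p q pe qe|v]; last exact: jT3.
    by rewrite jdef_rot jdef0l.
  by rewrite jdefDm jdefZm pe qe scaler0 addr0.
elim/scalext_ind: x => [|k p q pe qe|u]; last exact: jT2.
  by rewrite jdef0l.
by rewrite jdefDl jdefZl pe qe scaler0 addr0.
Qed.

Lemma generated_subalgebraP (S : set A) : subalgebra (generated_subalgebra S).
Proof.
split=> [U [] //|k u v Su Sv U sU SU|u v Su Sv U sU SU].
  by have [_ Ul _] := sU; apply: Ul; [apply: Su | apply: Sv].
by have [_ _ UM] := sU; apply: UM; [apply: Su | apply: Sv].
Qed.

Section Pair.
Variables (a b w b0 : A) (k : F).
Local Notation h := (2%:R^-1 : F).
Hypotheses (aa : a ** a = a) (aw : a ** w = h *: w) (ab0 : a ** b0 = 0)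
  (eb : b = k *: a + w + b0)
  (ww : w ** w = (k * (1 - k)) *: a + k *: b0)
  (wb0 : w ** b0 = (h * (1 - k)) *: w) (b00 : b0 ** b0 = (1 - k) *: b0).

Local Notation B := (generated_subalgebra [set a; b]).

Lemma pair_span u : B u -> exists x y z, u = x *: a + y *: w + z *: b0.
Proof.
move=> /(_ [set u | exists x y z, u = x *: a + y *: w + z *: b0]); apply; last first.
  move=> v [->|->]; first by exists 1, 0, 0; module_ring.
  by exists k, 1, 1; rewrite eb; module_ring.
split.
- by exists 0, 0, 0; module_ring.
- move=> l _ _ [x [y [z ->]]] [x' [y' [z' ->]]].
  by exists (l * x + x'), (l * y + y'), (l * z + z'); module_ring.
- move=> _ _ [x [y [z ->]]] [x' [y' [z' ->]]].
  exists (x * x' + y * y' * (k * (1 - k))).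
  exists (h * (x * y' + y * x') + h * (1 - k) * (y * z' + z * y')).
  exists (y * y' * k + z * z' * (1 - k)).
  rewrite !amulE [w ** a]amulC [b0 ** a]amulC [b0 ** w]amulC.
  by rewrite aa aw ab0 ww wb0 b00; module_ring.
Qed.

Lemma pair_gen x y z : B (x *: a + y *: w + z *: b0).
Proof.
have [B0 Bl BM] := generated_subalgebraP [set a; b].
have Ba : B a by move=> U _; apply; left.
have Bb : B b by move=> U _; apply; right.
(* From [w = 2 (a b - k a)] and [b0 = b - k a - w]. *)
have -> : x *: a + y *: w + z *: b0 = (2%:R * (y - z)) *: (a ** b) +
    ((x - k * z - 2%:R * k * (y - z)) *: a + (z *: b + 0)).
  by rewrite eb !amulE aa aw ab0; module_field.
by apply: (Bl); [apply: BM | do 2![apply: (Bl) => //]].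
Qed.

(** Solidity makes the points of the conic over [E] axes, so [tau_dot_mul] holds in [A_E]; it
    descends to [A] because [T] is injective. *)
Lemma pair_derpair : a <> 0 -> peirce a -> GRing.closed_field_axiom E ->
  solid iota a b -> derpair a b.
Proof.
move=> a0 pa closedE solid_ab.
have two_neq0E : (2%:R : E) != 0 by rewrite -(rmorph_nat iota) fmorph_eq0.
have Th : iota h = 2%:R^-1 by rewrite fmorphV rmorph_nat.
pose K := iota k.
have Taa : T a ** T a = T a by rewrite -tensM aa.
have Taw : T a ** T w = 2%:R^-1 *: T w by rewrite -tensM aw tensZ Th.
have Tab : T a ** T b0 = 0 by rewrite -tensM ab0 tens0.
have K1 : iota (1 - k) = 1 - K by rewrite rmorphB rmorph1.
have Tww : T w ** T w = (K * (1 - K)) *: T a + K *: T b0.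
  by rewrite -tensM ww !tensE rmorphM K1.
have Twb : T w ** T b0 = (2%:R^-1 * (1 - K)) *: T w.
  by rewrite -tensM wb0 tensZ rmorphM K1 Th.
have Tbb : T b0 ** T b0 = (1 - K) *: T b0 by rewrite -tensM b00 tensZ K1.
pose n := conic_norm K; pose N := conic (T a) (T w) (T b0) K.
pose BE : set AE := scalext_sub B.
have BEl (l : E) u v : BE u -> BE v -> BE (l *: u + v) by apply: linear_span_lin.
have BET u : B u -> BE (T u) by move=> Bu; apply: linear_span_sub; exists u.
have BE0 : BE 0 by apply: linear_span0.
have BEZ (l : E) u : BE u -> BE (l *: u).
  by move=> Bu; rewrite -[_ *: _]addr0; apply: (BEl).
have BEN s : BE (N s).
  have Ba : B a by have := pair_gen 1 0 0; rewrite scale1r !scale0r !addr0.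
  have Bw : B w by have := pair_gen 0 1 0; rewrite scale1r !scale0r add0r addr0.
  have Bb0 : B b0 by have := pair_gen 0 0 1; rewrite scale1r !scale0r !add0r.
  rewrite /N /conic addrC; apply: (BEl); first by apply: (BEZ); apply: (BET).
  by rewrite addrC; apply: (BEl); apply: (BET).
have BE_span : BE `<=` [set u | exists x y z, u = x *: T a + y *: T w + z *: T b0].
  apply: linear_span_ind.
  - by exists 0, 0, 0; module_ring.
  - move=> l _ _ [x [y [z ->]]] [x' [y' [z' ->]]].
    by exists (l * x + x'), (l * y + y'), (l * z + z'); module_ring.
  - move=> _ [u /pair_span[x [y [z ->]]] <-].
    by exists (iota x), (iota y), (iota z); rewrite !tensE.
have conic_axis s : n s != 0 -> peirce ((n s)^-1 *: N s).
  move=> n0.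
  suff /solid_ab/(J_half_axisP two_neq0E)[] :
    primitive_idempotent_in BE ((n s)^-1 *: N s) by [].
  have ci : idempotent_elt ((n s)^-1 *: N s).
    rewrite /idempotent_elt amulZl amulZr /N conic_idem // -/(n s) -/(N s).
    by rewrite [_^-1 *: (n s *: _)]scalerA mulVf // scale1r.
  split=> //.
  - exact: (BEZ).
  - move=> /eqP; rewrite scaler_eq0 invr_eq0 (negbTE n0) => /eqP.
    apply: conic_neq0 => // Ta0; apply: a0; apply: tens_inj.
    by rewrite Ta0 tens0.
  - apply/seteqP; split=> [u [Bu /= cu]|_ [l _ <-]].
      have Nu : N s ** u = n s *: u.
        have cu' : ((n s)^-1 *: N s) ** u = u := cu.
        by rewrite -{2}cu' amulZl scalerA divff // scale1r.
      have [x [y [z eu]]] := BE_span u Bu; move: Nu; rewrite eu => Nu.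
      have [p ->] := conic_eig1 two_neq0E Taa Taw Tab Tww Twb Tbb n0 Nu.
      exists (p * n s) => //.
      by rewrite scalerA mulfK.
    split; first by do 2!apply: (BEZ).
    by apply: (etrans (amulZr _ _ _)); rewrite ci.
have dot x y :=
  tau_dot_mul two_neq0E (T x) (T y) closedE conic_axis.
have Ttau x : tau (T a) (T x) = T (tau a x).
  by rewrite /tau !tensE !rmorph_nat.
have Tdot x : tau_dot (T a) (T w) (T x) = T (tau_dot a w x).
  by rewrite /tau_dot !tensE !rmorphN !rmorph_nat.
have dotM x y : tau_dot a w (x ** y) =
    tau_dot a w x ** tau a y + tau a x ** tau_dot a w y.
  by apply: tens_inj; rewrite tensD !tensM -!Ttau -!Tdot tensM dot.
have daw : derpair a w.
  (* Inverts [tau_dot_tau], using that [tau a] is an involution. *)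
  have e x : bra a w x = - (h * h * h) *: tau_dot a w (tau a x).
    rewrite (tau_dot_tau two_neq0 aw _ pa); module_field.
  move=> x y; rewrite !e (tau_mul two_neq0 pa) dotM !(tauK two_neq0 pa).
  by rewrite scalerDr amulZl amulZr.
have bab u : bra a b u = bra a w u.
  rewrite eb !braDr braZr braxx scaler0 add0r.
  by rewrite (bra_even u pa (e := b0)) ?addr0 // ab0 amul0r.
by move=> x y; rewrite !bab.
Qed.

End Pair.

Lemma solid_derpair (a b : A) : GRing.closed_field_axiom E ->
  prim a -> prim b -> solid iota a b -> derpair a b.
Proof.
move=> closedE qa qb; have [a0 pa _] := qa.
have [k [w [b0 [[aw ab0 eb] [ww wb0 b00]]]]] := prim_pair two_neq0 qa qb.
exact: pair_derpair (peirce_idem pa) aw ab0 eb ww wb0 b00 a0 pa closedE.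
Qed.

End Solid.

Theorem theorem1p3 (F : fieldType) (A : comAlg F) (X : set A)
    (char_neq2 : 2%N \notin [pchar F])
    (axialAX : primitive_axial_algebra X)
    (span_char3 : 3%N \in [pchar F] -> linear_span X = [set: A])
    (E : fieldType) (iota : {rmorphism F -> E})
    (closureE : algebraic_closure iota) :
  (forall a b : A, X a -> X b -> solid iota a b) <-> jordan A.
Proof.
have two_neq0 : (2%:R : F) != 0 by move: char_neq2; rewrite inE.
split=> [solidX|jA a b _ _]; last exact: jordan_solid.
have [Xaxis Xgen] := axialAX; have [closedE _] := closureE.
have Xprim a : X a -> prim a by move=> /Xaxis/(primP two_neq0).
have Xder a b : X a -> X b -> derpair a b.
  move=> Xa Xb; apply: (solid_derpair two_neq0 closedE) (solidX a b Xa Xb).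
    exact: Xprim.
  exact: Xprim.
(* In characteristic 3 [X] already spans; otherwise 3 is invertible and [X] is enlarged to a
   spanning set of axes. *)
have [three|three] := boolP (3%N \in [pchar F]).
  exact: (jordan_of_span two_neq0 Xprim Xder (span_char3 three)).
apply: (jordan_of_generators two_neq0 _ Xprim Xder Xgen).
by move: three; rewrite inE.
Qed.
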